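(* Let $\mathscr{M}=\{m_j\}_{j\in\mathbb{N}_0}$ be a weight sequence, let $A,B\in\mathbb{C}$, let $L=\sum_{0<|\alpha|\le m}c_\alpha\partial^\alpha$ with $c_\alpha\in\mathbb{C}$ be a constant-coefficient differential operator on $\mathbb{T}^n$, and let $P:\mathcal{E}_{\mathscr{M}}(\mathbb{T}^n)\to\mathcal{E}_{\mathscr{M}}(\mathbb{T}^n)$ be defined by $Pu=Lu-Au-B\bar u$. For $\xi\in\mathbb{Z}^n$ put $$\Delta_\xi=\left(\sigma_L(\xi)-A\right)\left(\overline{\sigma_L(-\xi)}-\bar A\right)-|B|^2 .$$ Then $P$ is $\mathscr{M}$-solvable if and only if for all $\varepsilon>0$ there exist constants $C_\varepsilon,\gamma_\varepsilon>0$ such that, for $\xi\in\mathbb{Z}^n$, $$\|\xi\|\ge\gamma_\varepsilon\ \Rightarrow\ |\Delta_\xi|\ge C_\varepsilon\inf_{j\in\mathbb{N}_0}\frac{m_j\,j!}{\varepsilon^j(1+\|\xi\|)^j}.$$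
   Context: $\mathbb{T}^n\simeq\mathbb{R}^n/2\pi\mathbb{Z}^n$; $\|\cdot\|$ is the Euclidean norm on $\mathbb{R}^n$; $\mathbb{N}_0=\{0,1,2,\dots\}$. A weight sequence is a sequence $\mathscr{M}=\{m_j\}_{j\in\mathbb{N}_0}$ of positive reals such that (i) $m_0=m_1=1$; (ii) $m_j^2\le m_{j-1}m_{j+1}$ for all $j\ge 1$; (iii) there is $H\ge1$ with $m_{j+k}\le H^{j+k}m_jm_k$ for all $j,k\in\mathbb{N}_0$. $\mathcal{E}_{\mathscr{M}}(\mathbb{T}^n)$ is the space of smooth functions $f:\mathbb{T}^n\to\mathbb{C}$ for which there exist $C,h>0$ with $\sup_{x\in\mathbb{T}^n}|\partial^\alpha f(x)|\le C h^{|\alpha|}m_{|\alpha|}|\alpha|!$ for all $\alpha\in\mathbb{N}_0^n$. The symbol of $L$ is $\sigma_L(\xi)=\sum_{0<|\alpha|\le m}i^{|\alpha|}c_\alpha\xi^\alpha$, $\xi\in\mathbb{Z}^n$. $P$ is called $\mathscr{M}$-solvable if there exists a subspace $\mathcal{F}\subset\mathcal{E}_{\mathscr{M}}(\mathbb{T}^n)$ of finite codimension such that for all $f\in\mathcal{F}$ there exists $u\in\mathcal{E}_{\mathscr{M}}(\mathbb{T}^n)$ with $Pu=f$. *)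

(* Defs.v *)
From HB Require Import structures.
From mathcomp Require Import all_boot all_order all_algebra.
From mathcomp Require Import complex.
From mathcomp Require Import all_classical all_reals all_analysis.

Set Implicit Arguments.
Unset Strict Implicit.
Unset Printing Implicit Defensive.

Import Order.TTheory GRing.Theory Num.Theory.
Import numFieldNormedType.Exports.

Local Open Scope classical_set_scope.
Local Open Scope ring_scope.

Definition weight_sequence (R : realType) (M : nat -> R) : Prop :=
  [/\ forall j, 0 < M j,
      M 0%N = 1 /\ M 1%N = 1,
      forall j, M j.+1 ^+ 2 <= M j * M j.+2 &
      exists2 H : R, 1 <= H &
        forall j k, M (j + k)%N <= H ^+ (j + k) * M j * M k].

(* The real-valued modulus; the norm [`|z|] of R[i] takes its values in R[i]. *)
Definition cmod (R : realType) (z : R[i]) : R := Normc.normc z.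

(* Functions on the torus R^n / 2 pi Z^n are represented by their lifts to R^n. *)
Definition periodic2pi (R : realType) n (f : 'rV[R]_n -> R[i]) : Prop :=
  forall (x : 'rV[R]_n) (k : 'rV[int]_n),
    f (x + \row_j (2 * pi * (k 0 j)%:~R)) = f x.

(* R[i] is not a normed R-module in the library, so complex-valued functions of
   real variables are differentiated through their real and imaginary parts. *)
Definition partial (R : realType) n (j : 'I_n) (f : 'rV[R]_n -> R[i])
    : 'rV[R]_n -> R[i] :=
  fun x => Complex (derive (@complex.Re R \o f) x (delta_mx 0 j))
                   (derive (@complex.Im R \o f) x (delta_mx 0 j)).

Definition partials (R : realType) n (s : seq 'I_n) (f : 'rV[R]_n -> R[i])
    : 'rV[R]_n -> R[i] :=
  foldr (fun j g => partial j g) f s.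

(* All iterated partial derivatives exist and are continuous.  The existence
   clause is needed because [derive] is a total operator. *)
Definition smooth (R : realType) n (f : 'rV[R]_n -> R[i]) : Prop :=
  forall s : seq 'I_n,
    [/\ continuous (@complex.Re R \o partials s f),
        continuous (@complex.Im R \o partials s f),
        forall x j, derivable (@complex.Re R \o partials s f) x (delta_mx 0 j) &
        forall x j, derivable (@complex.Im R \o partials s f) x (delta_mx 0 j)].

Definition mdegree n (alpha : 'I_n -> nat) : nat := (\sum_(j < n) alpha j)%N.

(* The operator d_0^(alpha 0) o ... o d_(n-1)^(alpha (n-1)). *)
Definition mpartial (R : realType) n (alpha : 'I_n -> nat)
    (f : 'rV[R]_n -> R[i]) : 'rV[R]_n -> R[i] :=
  foldr (fun j g => iter (alpha j) (partial j) g) f (enum 'I_n).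

Definition E_M (R : realType) n (M : nat -> R) : set ('rV[R]_n -> R[i]) :=
  [set f | [/\ periodic2pi f, smooth f &
    exists C h : R, [/\ 0 < C, 0 < h &
      forall (alpha : 'I_n -> nat) (x : 'rV[R]_n),
        cmod (mpartial alpha f x) <=
          C * h ^+ mdegree alpha * M (mdegree alpha) * (mdegree alpha)`!%:R]]].

(* A multi-index of length at most m has all its entries at most m, so such
   multi-indices live in the finite type {ffun 'I_n -> 'I_m.+1}.  The
   coefficients below at elements of length 0 or greater than m are never used. *)
Definition bmi n m (alpha : {ffun 'I_n -> 'I_m.+1}) : 'I_n -> nat :=
  fun j => alpha j.

Definition diffop (R : realType) n m (c : {ffun 'I_n -> 'I_m.+1} -> R[i])
    (u : 'rV[R]_n -> R[i]) : 'rV[R]_n -> R[i] :=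
  fun x => \sum_(alpha : {ffun 'I_n -> 'I_m.+1} | (0 < mdegree (bmi alpha) <= m)%N)
             c alpha * mpartial (bmi alpha) u x.

Definition symbol (R : realType) n m (c : {ffun 'I_n -> 'I_m.+1} -> R[i])
    (xi : 'rV[int]_n) : R[i] :=
  \sum_(alpha : {ffun 'I_n -> 'I_m.+1} | (0 < mdegree (bmi alpha) <= m)%N)
    'i%C ^+ mdegree (bmi alpha) * c alpha *
    \prod_(j < n) (xi 0 j)%:~R ^+ bmi alpha j.

Definition vekua_op (R : realType) n m (c : {ffun 'I_n -> 'I_m.+1} -> R[i])
    (A B : R[i]) (u : 'rV[R]_n -> R[i]) : 'rV[R]_n -> R[i] :=
  fun x => diffop c u x - A * u x - B * (u x)^*%C.

Definition Delta (R : realType) n m (c : {ffun 'I_n -> 'I_m.+1} -> R[i])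
    (A B : R[i]) (xi : 'rV[int]_n) : R[i] :=
  (symbol c xi - A) * ((symbol c (- xi))^*%C - A^*%C)
    - ((cmod B) ^+ 2)%:C%C.

Definition enorm (R : realType) n (xi : 'rV[int]_n) : R :=
  Num.sqrt (\sum_(j < n) ((xi 0 j)%:~R) ^+ 2).

(* F is a complex linear subspace of E, and finitely many elements of E span E
   modulo F. *)
Definition finite_codim_subspace (R : realType) (T : Type)
    (F E : set (T -> R[i])) : Prop :=
  [/\ F `<=` E,
      F (fun=> 0),
      forall (a : R[i]) f g, F f -> F g -> F (fun x => a * f x + g x) &
      exists (k : nat) (e : 'I_k -> T -> R[i]),
        (forall i, E (e i)) /\
        forall f, E f ->
          exists a : 'I_k -> R[i], F (fun x => f x - \sum_(i < k) a i * e i x)].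

Definition M_solvable (R : realType) n (M : nat -> R)
    (P : ('rV[R]_n -> R[i]) -> ('rV[R]_n -> R[i])) : Prop :=
  exists2 F : set ('rV[R]_n -> R[i]), finite_codim_subspace F (E_M M) &
    forall f, F f -> exists2 u, E_M M u & P u = f.

(* Main.v *)
Require Import Defs.
From mathcomp Require Import all_boot all_order all_algebra.
From mathcomp Require Import complex.
From mathcomp Require Import all_classical all_reals all_analysis.
From mathcomp Require Import ring lra zify.
Set Implicit Arguments.
Unset Strict Implicit.
Unset Printing Implicit Defensive.
Import Order.TTheory GRing.Theory Num.Theory.
Import numFieldNormedType.Exports.
Local Open Scope classical_set_scope.
Local Open Scope ring_scope.

(* A function of class [E_M] is the sum of its Fourier series, and membership in
   [E_M] means that the coefficients satisfy, for some h,
   |a xi| (1 + |xi|)^p <= C h^p M_p p! for all p.  On coefficients, P u = f is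
   the 2 x 2 system in u^(xi) and conj (u^(-xi)) whose determinant is Delta_xi.
   If |Delta_xi| is bounded below by the gauges inf_j M_j j! / (eps (1 + |xi|))^j,
   Cramer's rule together with M_(j+k) (j+k)! <= H^(j+k) M_j j! M_k k! shows that
   the solution has coefficients of the same class as soon as f has no
   frequency in a fixed ball.  Otherwise |Delta| is much smaller than a gauge on
   a sequence of frequencies; putting gauges on k+1 disjoint subsequences gives
   k+1 functions of [E_M], some combination of which lies in a given subspace of
   codimension k, while a solution for it would have unbounded coefficients.

   Instead of the integral over the torus, Fourier coefficients use the limit,
   along a free ultrafilter, of the averages over the grids 2 pi Z^n / N!.  This
   mean is linear on bounded functions and invariant under rational
   translations, so it kills uniform derivatives, which is all that the theory
   of Fourier coefficients needs. *)

(** Conjugation ties the frequency [xi] to [- xi], and this shapes both directions. The two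
    determinants are conjugate, so one quotient formula solves both equations at once. For necessity
    the data are large at [zeta] and vanish at [- zeta], which isolates one term of the cofactor. If
    B is nonzero, that term is B times a conjugated datum, and smallness of Delta passes directly to
    the datum. If B = 0, Delta is a product of two factors and only the smaller one is controlled,
    by the square root of a gauge; since a gauge is at most the square of a gauge with another eps,
    this loss is harmless. The combination that falls into the subspace is not known in advance.
    Some coefficient of it is nonzero, and its subsequence carries infinitely many bad frequencies,
    along which the constants 1 / (l + 1) tend to 0 while a solution keeps bounded coefficients.
    Sums and means are both ultrafilter limits, so the coefficients of a series are computed by
    writing it through derivatives instead of interchanging limits; uniqueness rests on powers of a
    trigonometric polynomial peaking at a point. *)

Section Modulus.
Variable R : realType.
Implicit Types (x y z : R[i]) (a : R).
Local Notation Re := (@complex.Re R).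
Local Notation Im := (@complex.Im R).

Lemma cReD x y : Re (x + y) = Re x + Re y. Proof. by case: x y => [? ?] []. Qed.
Lemma cImD x y : Im (x + y) = Im x + Im y. Proof. by case: x y => [? ?] []. Qed.
Lemma cReN x : Re (- x) = - Re x. Proof. by case: x. Qed.
Lemma cImN x : Im (- x) = - Im x. Proof. by case: x. Qed.
Lemma cReM x y : Re (x * y) = Re x * Re y - Im x * Im y.
Proof. by case: x y => [? ?] []. Qed.
Lemma cImM x y : Im (x * y) = Re x * Im y + Im x * Re y.
Proof. by case: x y => [? ?] []. Qed.

Lemma complex_ext x y : Re x = Re y -> Im x = Im y -> x = y.
Proof. by case: x y => [? ?] [? ?] /= -> ->. Qed.

Lemma cconjD x y : (x + y)^*%C = x^*%C + y^*%C.
Proof. by case: x y => [? ?] [? ?]; apply: complex_ext => //=; rewrite opprD. Qed.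
Lemma cconjN x : (- x)^*%C = - x^*%C.
Proof. by case: x. Qed.
Lemma cconjB x y : (x - y)^*%C = x^*%C - y^*%C.
Proof. by rewrite cconjD cconjN. Qed.
Lemma cconjM x y : (x * y)^*%C = x^*%C * y^*%C.
Proof. by case: x y => [? ?] [? ?]; apply: complex_ext => /=; ring. Qed.
Lemma cconjV x : (x^-1)^*%C = (x^*%C)^-1.
Proof. exact: conjc_inv. Qed.
Lemma cconjK x : (x^*)^*%C = x.
Proof. exact: conjcK. Qed.

Lemma cmod_ge0 z : 0 <= cmod z.
Proof. by case: z => a b; rewrite /cmod /= sqrtr_ge0. Qed.
Lemma cmod0 : cmod (0 : R[i]) = 0. Proof. exact: Normc.normc0. Qed.
Lemma cmod1 : cmod (1 : R[i]) = 1. Proof. exact: Normc.normc1. Qed.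
Lemma cmodM x y : cmod (x * y) = cmod x * cmod y.
Proof. exact: Normc.normcM. Qed.
Lemma cmodV x : cmod x^-1 = (cmod x)^-1. Proof. exact: Normc.normcV. Qed.
Lemma cmodX x k : cmod (x ^+ k) = cmod x ^+ k.
Proof. by elim: k => [|k ih]; rewrite ?expr0 ?cmod1 // !exprS cmodM ih. Qed.
Lemma cmod_prod (I : Type) (s : seq I) (f : I -> R[i]) :
  cmod (\prod_(i <- s) f i) = \prod_(i <- s) cmod (f i).
Proof. by elim/big_ind2: _ => [|? ? ? ? <- <-|//]; rewrite ?cmod1 ?cmodM. Qed.
Lemma cmodD x y : cmod (x + y) <= cmod x + cmod y.
Proof. exact: le_normcD. Qed.
Lemma cmodN x : cmod (- x) = cmod x. Proof. exact: normcN. Qed.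
Lemma cmodB x y : cmod (x - y) <= cmod x + cmod y.
Proof. by rewrite -[in leRHS](cmodN y) cmodD. Qed.
Lemma cmod_eq0 x : (cmod x == 0) = (x == 0).
Proof. by apply/eqP/eqP => [/Normc.eq0_normc|->] //; rewrite cmod0. Qed.
Lemma cmod_gt0 x : (0 < cmod x) = (x != 0).
Proof. by rewrite lt_def cmod_ge0 cmod_eq0 andbT. Qed.
Lemma cmod_conj x : cmod x^*%C = cmod x.
Proof. by case: x => a b; rewrite /cmod /= sqrrN. Qed.
Lemma cmod_real a : cmod a%:C%C = `|a|.
Proof. by rewrite /cmod /= expr0n addr0 sqrtr_sqr. Qed.
Lemma cmod_i : cmod ('i%C : R[i]) = 1.
Proof. by rewrite /cmod /= expr0n expr1n add0r sqrtr1. Qed.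
Lemma cmod_int (k : int) : cmod (k%:~R : R[i]) = `|k%:~R : R|.
Proof. by rewrite -cmod_real; congr cmod; rewrite rmorph_int. Qed.
Lemma cmod_sum (I : Type) (s : seq I) (P : pred I) (f : I -> R[i]) :
  cmod (\sum_(i <- s | P i) f i) <= \sum_(i <- s | P i) cmod (f i).
Proof.
elim/big_ind2: _ => [|x1 x2 y1 y2 h1 h2|//]; first by rewrite cmod0.
by rewrite (le_trans (cmodD _ _)) // lerD.
Qed.
Lemma cmod_Re z : `|Re z| <= cmod z.
Proof.
case: z => a b; rewrite /cmod /= -sqrtr_sqr ler_wsqrtr //.
by rewrite lerDl sqr_ge0.
Qed.
Lemma cmod_Im z : `|Im z| <= cmod z.
Proof.
case: z => a b; rewrite /cmod /= -sqrtr_sqr ler_wsqrtr //.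
by rewrite lerDr sqr_ge0.
Qed.
Lemma cmod_le_ReIm z : cmod z <= `|Re z| + `|Im z|.
Proof.
rewrite [z in cmod z]complexE (le_trans (cmodD _ _)) //.
by rewrite cmodM cmod_i mul1r !cmod_real.
Qed.

End Modulus.

(** * Ultrafilter limits *)

(* A limit along a fixed free ultrafilter makes every bounded sequence converge. *)
Section UltraLimit.
Variable R : realType.
Local Notation Re := (@complex.Re R).
Local Notation Im := (@complex.Im R).

Definition ulF : set_system nat :=
  projT1 (cid (ultraFilterLemma eventually_filter)).

Let ulF_ultra : UltraFilter ulF.
Proof. by rewrite /ulF; case: (cid _) => G []. Qed.

Local Instance ulF_proper : ProperFilter ulF.
Proof. exact: (@ultra_proper _ _ ulF_ultra). Qed.

Lemma ulF_eventually (P : nat -> Prop) N0 :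
  (forall N, (N0 <= N)%N -> P N) -> ulF P.
Proof.
move=> h; rewrite /ulF; case: (cid _) => G [_ sub] /=; apply: sub.
by exists N0.
Qed.

(** The limit is the supremum of the levels [c] with [c <= u N] on a set of the ultrafilter. For a
    level above it that set is not in the ultrafilter, so its complement is, and this bounds [u]
    from above. *)
Lemma bounded_cvg_ulF (u : nat -> R) C :
  (forall N, `|u N| <= C) -> cvg (u x @[x --> ulF]).
Proof.
move=> hC; pose S := [set c | ulF [set N | c <= u N]].
have Sm : S (- C).
  by apply: (@ulF_eventually _ 0) => N _ /=; move: (hC N); rewrite ler_norml => /andP[].
have Sub : ubound S C.
  move=> c /= Sc; have [N] := filter_ex Sc.
  by move=> /le_trans; apply; rewrite (le_trans _ (hC N)) // ler_norm.
have hs : has_sup S by split; [exists (- C)|exists C].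
apply/cvg_ex; exists (sup S); apply/cvgrPdist_le => e e0.
have F1 : ulF [set N | sup S - e <= u N].
  have [c Sc /ltW hc] := sup_adherent e0 hs.
  by apply: filterS Sc => N /= h; rewrite (le_trans hc).
have F2 : ulF [set N | ~ (sup S + e <= u N)].
  have [h|//] := in_ultra_setVsetC [set N | sup S + e <= u N] ulF_ultra.
  have := sup_upper_bound hs h.
  by rewrite gerDl leNgt e0.
apply: filterS2 F1 F2 => N /= h1 /negP; rewrite -ltNge => h2.
by rewrite ler_norml; apply/andP; split; lra.
Qed.

Definition ulim (u : nat -> R[i]) : R[i] :=
  Complex (lim (Re (u N) @[N --> ulF])) (lim (Im (u N) @[N --> ulF])).

Definition bdd (T : Type) (f : T -> R[i]) := exists C, forall t, cmod (f t) <= C.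

Lemma bddD T (f g : T -> R[i]) : bdd f -> bdd g -> bdd (fun t => f t + g t).
Proof.
by move=> [C hC] [D hD]; exists (C + D) => t; rewrite (le_trans (cmodD _ _)) ?lerD.
Qed.

Lemma bddM T (f g : T -> R[i]) : bdd f -> bdd g -> bdd (fun t => f t * g t).
Proof.
move=> [C hC] [D hD]; exists (C * D) => t.
by rewrite cmodM ler_pM ?cmod_ge0.
Qed.

Lemma bdd_cst T (c : R[i]) : bdd (fun _ : T => c).
Proof. by exists (cmod c). Qed.

Lemma bddZ T (c : R[i]) (f : T -> R[i]) : bdd f -> bdd (fun t => c * f t).
Proof. exact/bddM/bdd_cst. Qed.

Lemma bdd_conj T (f : T -> R[i]) : bdd f -> bdd (fun t => (f t)^*%C).
Proof. by move=> [C hC]; exists C => t; rewrite cmod_conj. Qed.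

Lemma bdd_sum T (I : Type) (s : seq I) (P : pred I) (f : I -> T -> R[i]) :
  (forall i, bdd (f i)) -> bdd (fun t => \sum_(i <- s | P i) f i t).
Proof.
move=> hf; elim: s => [|i s ih].
  by under eq_fun do rewrite big_nil; exact: bdd_cst.
under eq_fun do rewrite big_cons.
by case: (P i) => //; apply: bddD.
Qed.

Lemma bdd_cvg_Re (u : nat -> R[i]) : bdd u -> cvg (Re (u N) @[N --> ulF]).
Proof.
move=> [C hC]; apply: (@bounded_cvg_ulF _ C) => N.
exact: le_trans (cmod_Re _) (hC N).
Qed.

Lemma bdd_cvg_Im (u : nat -> R[i]) : bdd u -> cvg (Im (u N) @[N --> ulF]).
Proof.
move=> [C hC]; apply: (@bounded_cvg_ulF _ C) => N.
exact: le_trans (cmod_Im _) (hC N).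
Qed.

Lemma ulim_near (u v : nat -> R[i]) N0 :
  (forall N, (N0 <= N)%N -> u N = v N) -> ulim u = ulim v.
Proof.
move=> h.
have key (p : R[i] -> R) : lim (p (u N) @[N --> ulF]) = lim (p (v N) @[N --> ulF]).
  congr (lim _); apply/seteqP; split => A /= hA.
    by apply: filterS2 hA (ulF_eventually h) => N /= + <-.
  by apply: filterS2 hA (ulF_eventually h) => N /= + ->.
by rewrite /ulim !key.
Qed.

Lemma ulim_cst (c : R[i]) : ulim (fun=> c) = c.
Proof. by rewrite /ulim !lim_cst //; case: c. Qed.

Lemma ulimD (u v : nat -> R[i]) : bdd u -> bdd v ->
  ulim (fun N => u N + v N) = ulim u + ulim v.
Proof.
move=> bu bv; rewrite /ulim.
under [fun N => Re _]eq_fun do rewrite cReD.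
under [fun N => Im _]eq_fun do rewrite cImD.
rewrite (limD (bdd_cvg_Re bu) (bdd_cvg_Re bv)).
by rewrite (limD (bdd_cvg_Im bu) (bdd_cvg_Im bv)).
Qed.

Lemma ulimZ (c : R[i]) (u : nat -> R[i]) : bdd u ->
  ulim (fun N => c * u N) = c * ulim u.
Proof.
move=> bu; have [cR cI] := (bdd_cvg_Re bu, bdd_cvg_Im bu).
rewrite /ulim.
under [fun N => Re _]eq_fun do rewrite cReM.
under [fun N => Im _]eq_fun do rewrite cImM.
apply: complex_ext; rewrite ?cReM ?cImM /=; apply/cvg_lim => //.
- by apply: cvgB; apply: cvgMl_tmp.
- by apply: cvgD; apply: cvgMl_tmp.
Qed.

Lemma ulim_conj (u : nat -> R[i]) : bdd u ->
  ulim (fun N => (u N)^*%C) = (ulim u)^*%C.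
Proof.
move=> bu; have [cR cI] := (bdd_cvg_Re bu, bdd_cvg_Im bu).
have eR z : Re z^*%C = Re z by case: z.
have eI z : Im z^*%C = - Im z by case: z.
rewrite /ulim; under [fun N => Re _]eq_fun do rewrite eR.
under [fun N => Im _]eq_fun do rewrite eI.
by apply: complex_ext => //=; apply/cvg_lim => //; apply: cvgN.
Qed.

Lemma ulim_Re_ge (u : nat -> R[i]) c : bdd u ->
  (forall N, c <= Re (u N)) -> c <= Re (ulim u).
Proof.
move=> bu h; apply: limr_ge; first exact: bdd_cvg_Re.
exact: nearW.
Qed.

(** Real and imaginary parts are bounded separately, hence the factor 2, which only enlarges later
    constants. *)
Lemma cmod_ulim (u : nat -> R[i]) C :
  (forall N, cmod (u N) <= C) -> cmod (ulim u) <= 2 * C.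
Proof.
move=> hC; have bu : bdd u by exists C.
rewrite (le_trans (cmod_le_ReIm _)) // mulr_natl mulr2n lerD //= ler_norml.
- apply/andP; split.
    apply: limr_ge; first exact: bdd_cvg_Re.
    apply: nearW => N; move: (le_trans (cmod_Re _) (hC N)).
    by rewrite ler_norml => /andP[].
  apply: limr_le; first exact: bdd_cvg_Re.
  apply: nearW => N; move: (le_trans (cmod_Re _) (hC N)).
  by rewrite ler_norml => /andP[].
- apply/andP; split.
    apply: limr_ge; first exact: bdd_cvg_Im.
    apply: nearW => N; move: (le_trans (cmod_Im _) (hC N)).
    by rewrite ler_norml => /andP[].
  apply: limr_le; first exact: bdd_cvg_Im.
  apply: nearW => N; move: (le_trans (cmod_Im _) (hC N)).
  by rewrite ler_norml => /andP[].
Qed.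

End UltraLimit.

(** * A mean invariant under rational translations *)

Section Mean.
Variables (R : realType) (n : nat).
Local Notation Re := (@complex.Re R).
Local Notation Im := (@complex.Im R).
Implicit Types (f g : 'rV[R]_n -> R[i]) (x : 'rV[R]_n).

Definition gridv k (d : 'I_n -> nat) : 'rV[R]_n :=
  \row_j (2 * pi * (d j)%:R / k%:R).

Lemma periodic_gridv f x k (d d' e : 'I_n -> nat) : (0 < k)%N ->
  periodic2pi f -> (forall j, d j = d' j + e j * k)%N ->
  f (x + gridv k d) = f (x + gridv k d').
Proof.
move=> k0 pf hd; rewrite -(pf (x + gridv k d') (\row_j (e j)%:Z)).
congr f; rewrite -addrA; congr (_ + _); apply/rowP => j; rewrite !mxE hd.
have kn : k%:R != 0 :> R by rewrite pnatr_eq0 -lt0n.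
by rewrite natrD natrM -pmulrn; field.
Qed.

(** The parameter is one less than the number of points per axis: ['I_k.+1] is then a nonempty
    cyclic group, and grid translations are additions in it. *)
Definition gmean k f : R[i] :=
  (#|{: 'rV['I_k.+1]_n}|%:R)^-1 *
    \sum_(r : 'rV['I_k.+1]_n) f (gridv k.+1 (fun j => r 0 j)).

Lemma gmean_translate k f (d : 'I_n -> nat) : periodic2pi f ->
  gmean k (fun x => f (x + gridv k.+1 d)) = gmean k f.
Proof.
move=> pf; rewrite /gmean; congr (_ * _).
pose D : 'rV['I_k.+1]_n := \row_j inZp (d j).
rewrite [RHS](reindex_inj (addIr D)) /=; apply: eq_bigr => r _.
have := @periodic_gridv f 0 k.+1 (fun j => r 0%R j + d j)%N
  (fun j => (r + D) 0 j) (fun j => (r 0%R j + d j) %/ k.+1)%N isT pf.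
rewrite !add0r => <-; last first.
  by move=> j; rewrite !mxE /= modnDmr [LHS](divn_eq _ k.+1) addnC.
by congr f; apply/rowP => j; rewrite !mxE natrD; ring.
Qed.

Lemma cmod_gmean k f C : (forall x, cmod (f x) <= C) -> cmod (gmean k f) <= C.
Proof.
move=> hC; rewrite /gmean; set c := #|_|.
have c0 : (0 < c)%N by apply/card_gt0P; exists 0.
have -> : (c%:R : R[i])^-1 = (c%:R : R)^-1%:C%C by rewrite fmorphV rmorph_nat.
rewrite cmodM cmod_real ger0_norm ?invr_ge0 // ler_pdivrMl ?ltr0n //.
rewrite (le_trans (cmod_sum _ _ _)) // (le_trans (ler_sum _ (fun r _ => hC _))) //.
by rewrite sumr_const mulr_natl.
Qed.

Lemma gmean_lin k (c : R[i]) f g :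
  gmean k (fun x => c * f x + g x) = c * gmean k f + gmean k g.
Proof. by rewrite /gmean big_split -mulr_sumr /= mulrDr mulrCA. Qed.

Lemma gmean_cst k (c : R[i]) : gmean k (fun=> c) = c.
Proof.
rewrite /gmean sumr_const; set m := #|_|.
have c0 : (0 < m)%N by apply/card_gt0P; exists 0.
by rewrite -[c *+ m]mulr_natl mulKf // pnatr_eq0 -lt0n.
Qed.

Lemma gmean_conj k f : gmean k (fun x => (f x)^*%C) = (gmean k f)^*%C.
Proof. by rewrite /gmean rmorphM rmorph_sum fmorphV rmorph_nat. Qed.

Lemma gmean_Re_ge k f c : (forall x, c <= Re (f x)) -> c <= Re (gmean k f).
Proof.
move=> h; rewrite /gmean; set m := #|_|.
have c0 : (0 < m)%N by apply/card_gt0P; exists 0.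
have -> : (m%:R : R[i])^-1 = (m%:R : R)^-1%:C%C by rewrite fmorphV rmorph_nat.
rewrite cReM /= mul0r subr0 ler_pdivlMl ?ltr0n //.
have -> : Re (\sum_(r : 'rV['I_k.+1]_n) f (gridv k.+1 (fun j => r 0 j))) =
    \sum_(r : 'rV['I_k.+1]_n) Re (f (gridv k.+1 (fun j => r 0 j))).
  by elim/big_rec2: _ => // r a b _ <-; rewrite cReD.
rewrite (le_trans _ (ler_sum _ (fun r _ => h _))) //.
by rewrite sumr_const mulr_natl.
Qed.

(* The grids of mesh 2 pi / N! eventually contain every rational multiple of
   2 pi, which makes the limit mean invariant under all rational translations. *)
Definition mean f : R[i] := ulim (fun N => gmean (N`!).-1 f).

Lemma bdd_gmean f : bdd f -> bdd (fun N => gmean (N`!).-1 f).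
Proof. by move=> [C hC]; exists C => N; exact: cmod_gmean. Qed.

Lemma mean_lin (c : R[i]) f g : bdd f -> bdd g ->
  mean (fun x => c * f x + g x) = c * mean f + mean g.
Proof.
move=> bf bg; rewrite /mean; under eq_fun do rewrite gmean_lin.
by rewrite ulimD ?ulimZ //; do ?apply: bddZ; exact: bdd_gmean.
Qed.

Lemma mean_cst (c : R[i]) : mean (fun=> c) = c.
Proof. by rewrite /mean; under eq_fun do rewrite gmean_cst; exact: ulim_cst. Qed.

Lemma meanD f g : bdd f -> bdd g -> mean (fun x => f x + g x) = mean f + mean g.
Proof.
move=> bf bg; have := mean_lin 1 bf bg.
by rewrite mul1r; under eq_fun do rewrite mul1r.
Qed.

Lemma mean_sum (I : Type) (s : seq I) (F : I -> 'rV[R]_n -> R[i]) :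
  (forall i, bdd (F i)) ->
  mean (fun x => \sum_(i <- s) F i x) = \sum_(i <- s) mean (F i).
Proof.
move=> bF; elim: s => [|i s ih].
  by rewrite big_nil; under eq_fun do rewrite big_nil; exact: mean_cst.
rewrite big_cons; under eq_fun do rewrite big_cons.
by rewrite meanD ?ih //; exact: bdd_sum.
Qed.

Lemma mean_conj f : bdd f -> mean (fun x => (f x)^*%C) = (mean f)^*%C.
Proof.
move=> bf; rewrite /mean; under eq_fun do rewrite gmean_conj.
by rewrite ulim_conj //; exact: bdd_gmean.
Qed.

Lemma cmod_mean f C : (forall x, cmod (f x) <= C) -> cmod (mean f) <= 2 * C.
Proof. by move=> h; apply: cmod_ulim => N; exact: cmod_gmean. Qed.

Lemma mean_Re_ge f c : bdd f -> (forall x, c <= Re (f x)) -> c <= Re (mean f).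
Proof.
move=> bf h; apply: ulim_Re_ge; first exact: bdd_gmean.
by move=> N; exact: gmean_Re_ge.
Qed.

Lemma mean_translate f q (d : 'I_n -> nat) : periodic2pi f -> (0 < q)%N ->
  mean (fun x => f (x + gridv q d)) = mean f.
Proof.
move=> pf q0; apply: (@ulim_near _ _ _ q) => N qN.
have Npos := fact_gt0 N.
have -> : gridv q d = gridv (N`!).-1.+1 (fun j => d j * (N`! %/ q))%N.
  apply/rowP => j; rewrite !mxE prednK //.
  have dv : (q %| N`!)%N by rewrite dvdn_fact // q0 qN.
  have qn : q%:R != 0 :> R by rewrite pnatr_eq0 -lt0n.
  have un : (N`! %/ q)%:R != 0 :> R.
    by rewrite pnatr_eq0 -lt0n divn_gt0 // dvdn_leq.
  rewrite -{2}(divnK dv) !natrM; field.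
  by rewrite qn.
exact: gmean_translate.
Qed.

Lemma bdd_translate f (v : 'rV[R]_n) : bdd f -> bdd (fun x => f (x + v)).
Proof. by move=> [C hC]; exists C. Qed.

Definition edir (j : 'I_n) : 'rV[R]_n := delta_mx 0 j.

(* [g] is the derivative of [f] in direction [j], with a Taylor remainder that
   is uniform over the whole space. *)
Definition uderiv (j : 'I_n) f g : Prop :=
  [/\ bdd f, bdd g &
    exists K, forall x (h : R), `|h| <= 1 ->
      cmod (f (x + h *: edir j) - f x - h%:C%C * g x) <= K * h ^+ 2].

(** A translation by a rational multiple of 2 pi does not change the mean of [f], so only the
    remainder is left and [cmod (mean g) <= 2 * K * h], with [h] as small as desired. *)
Lemma uderiv_mean j f g : periodic2pi f -> uderiv j f g -> mean g = 0.
Proof.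
move=> pf [bf bg [K hK]]; apply/eqP; rewrite -cmod_eq0.
have K0 : 0 <= K.
  by have := hK 0 1; rewrite normr1 lexx => /(_ isT); rewrite expr1n mulr1 => hK0; exact: le_trans (cmod_ge0 _) hK0.
rewrite eq_le cmod_ge0 andbT leNgt; apply/negP => m0.
pose m := cmod (mean g).
(* The first bound puts [h = 2 * pi / q.+1] in the range of the Taylor estimate, the second makes
   [2 * K * h] smaller than [m]. *)
have [q hq] : exists q : nat, 2 * pi <= q.+1%:R :> R /\ 2 * K * (2 * pi) < m * q.+1%:R.
  pose X := Num.max (2 * pi) (2 * K * (2 * pi) / m).
  exists (Num.Def.archi_bound X).
  have hX : X < (Num.Def.archi_bound X).+1%:R.
    rewrite (lt_trans (y := (Num.Def.archi_bound X)%:R)) ?ltr_nat //.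
    by apply: archi_boundP; rewrite le_max mulr_ge0 ?pi_ge0.
  split; first by rewrite (le_trans _ (ltW hX)) // le_max lexx.
  by rewrite -ltr_pdivrMl // mulrC (le_lt_trans _ hX) // le_max lexx orbT.
case: hq => hq1 hq2.
pose h : R := 2 * pi / q.+1%:R.
have h0 : 0 < h by rewrite divr_gt0 ?mulr_gt0 ?pi_gt0.
have h1 : `|h| <= 1 by rewrite gtr0_norm // ler_pdivrMr // mul1r.
have eh : h *: edir j = gridv q.+1 (fun j' => (j' == j) : nat).
  by apply/rowP => i; rewrite !mxE /= eq_sym; case: eqP => _ /=; rewrite /h; field.
pose r x := f (x + h *: edir j) - f x - h%:C%C * g x.
have E : mean r = - (h%:C%C * mean g).
  have -> : r = (fun x => - h%:C%C * g x + (-1 * f x + f (x + h *: edir j))).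
    by apply/funext => x; rewrite /r; ring.
  rewrite mean_lin //; last first.
    by apply: bddD; [exact: bddZ|exact: bdd_translate].
  rewrite mean_lin //; last exact: bdd_translate.
  rewrite eh mean_translate //; ring.
have := cmod_mean (fun x => hK x h h1).
rewrite -/r E cmodN cmodM cmod_real gtr0_norm // -/m => H.
have {}H : m <= 2 * K * h.
  by rewrite -(ler_pM2l h0) (le_trans H) //; rewrite le_eqVlt; apply/orP; left; apply/eqP; ring.
move: hq2; rewrite ltNge => /negP; apply.
by rewrite -ler_pdivlMr // (le_trans H) // /h mulrA.
Qed.

(** With a character as one factor, this turns [uderiv_mean] into integration by parts. *)
Lemma uderivM j f1 g1 f2 g2 : uderiv j f1 g1 -> uderiv j f2 g2 ->
  uderiv j (fun x => f1 x * f2 x) (fun x => g1 x * f2 x + f1 x * g2 x).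
Proof.
move=> [bf1 bg1 [K1 h1]] [bf2 bg2 [K2 h2]]; split.
- exact: bddM.
- by apply: bddD; exact: bddM.
case: bf1 bg1 bf2 bg2 => [B1 b1] [C1 c1] [B2 b2] [C2 c2].
exists (K1 * B2 + B1 * K2 + C1 * (C2 + K2)) => x h hh.
have hab2 : h ^+ 2 = `|h| * `|h| by rewrite -normrM -expr2 ger0_norm ?sqr_ge0.
have K20 : 0 <= K2.
  by have := h2 0 1; rewrite normr1 lexx => /(_ isT); rewrite expr1n mulr1 => hK0; exact: le_trans (cmod_ge0 _) hK0.
pose s1 := f1 (x + h *: edir j) - f1 x - h%:C%C * g1 x.
pose s2 := f2 (x + h *: edir j) - f2 x - h%:C%C * g2 x.
have H1 : cmod s1 <= K1 * h ^+ 2 := h1 x h hh.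
have H2 : cmod s2 <= K2 * h ^+ 2 := h2 x h hh.
(* The first two terms carry the remainders [s1] and [s2]; the last is quadratic in [h] because |h|
   <= 1 bounds [s2] by [K2] times |h|. *)
have -> : f1 (x + h *: edir j) * f2 (x + h *: edir j) - f1 x * f2 x -
    h%:C%C * (g1 x * f2 x + f1 x * g2 x) =
    s1 * f2 (x + h *: edir j) + f1 x * s2 + h%:C%C * g1 x * (h%:C%C * g2 x + s2).
  by rewrite /s1 /s2; ring.
clearbody s1 s2; rewrite (le_trans (cmodD _ _)) // !mulrDl; apply: lerD.
  rewrite (le_trans (cmodD _ _)) //; apply: lerD.
    by rewrite cmodM mulrAC ler_pM ?cmod_ge0.
  by rewrite cmodM -mulrA ler_pM ?cmod_ge0.
rewrite !cmodM cmod_real hab2 [C1 * _]mulrC.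
rewrite (_ : (C2 + K2) * C1 * (`|h| * `|h|) = (`|h| * C1) * (C2 * `|h| + K2 * `|h|)); last by ring.
rewrite ler_pM ?mulr_ge0 ?cmod_ge0 ?ler_wpM2l // (le_trans (cmodD _ _)) //.
rewrite lerD // ?cmodM ?cmod_real ?[C2 * _]mulrC ?ler_wpM2l //.
rewrite (le_trans H2) // hab2 ler_wpM2l // -[leRHS]mulr1 ler_wpM2l //.
Qed.

End Mean.

(** * Taylor estimates in one variable *)

Section Taylor.
Variable R : realType.
Implicit Types (phi : R -> R).

Lemma mean_value0 phi (dphi : R -> R) (h : R) :
  (forall t : R, is_derive t 1 phi (dphi t)) ->
  exists2 c, `|c| <= `|h| & phi h - phi 0 = dphi c * h.
Proof.
move=> hd.
have cont : continuous phi.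
  move=> t; apply/differentiable_continuous/derivable1_diffP.
  by have [] := hd t.
have [h0|h0] := leP 0 h.
  have [c] := MVT_segment h0 (fun x _ => hd x) (continuous_subspaceT cont).
  rewrite in_itv /= subr0 => /andP[c0 ch] e; exists c => //.
  by rewrite !ger0_norm.
have [c] := MVT_segment (ltW h0) (fun x _ => hd x) (continuous_subspaceT cont).
rewrite in_itv /= sub0r => /andP[c0 ch] e; exists c => //.
  by rewrite (ltr0_norm h0) ler0_norm // lerN2.
by rewrite -opprB e mulrN opprK.
Qed.

(** Two applications of the mean value theorem, the second at a point no farther from 0 than [h];
    the cost is the factor 1/2 of the sharp constant. *)
Lemma taylor1 phi (dphi ddphi : R -> R) B (h : R) :
  (forall t : R, is_derive t 1 phi (dphi t)) ->
  (forall t : R, is_derive t 1 dphi (ddphi t)) ->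
  (forall t, `|ddphi t| <= B) ->
  `|phi h - phi 0 - dphi 0 * h| <= B * h ^+ 2.
Proof.
move=> h1 h2 hB; have [c ch ->] := mean_value0 h h1.
have [d _ E] := mean_value0 c h2.
rewrite -mulrBl E !normrM -mulrA ler_pM ?mulr_ge0 //.
by rewrite -real_normK ?num_real // expr2 ler_wpM2r.
Qed.

Lemma cos_sub1_le (t : R) : `|cos t - 1| <= t ^+ 2.
Proof.
have hN (x : R) : is_derive x 1 (fun t : R => - sin t) (- cos x).
  exact: is_deriveN (is_derive_sin x).
have b (x : R) : `|- cos x| <= 1 by rewrite normrN ler_norml cos_geN1 cos_le1.
have := taylor1 t (@is_derive_cos R) hN b.
by rewrite cos0 sin0 oppr0 mul0r subr0 mul1r.
Qed.

Lemma sin_sub_le (t : R) : `|sin t - t| <= t ^+ 2.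
Proof.
have b (x : R) : `|- sin x| <= 1 by rewrite normrN ler_norml sin_geN1 sin_le1.
have := taylor1 t (@is_derive_sin R) (@is_derive_cos R) b.
by rewrite cos0 sin0 subr0 !mul1r.
Qed.

Lemma cos_sub1_lip (t : R) : `|cos t - 1| <= `|t|.
Proof.
rewrite -cos0; have [c _ ->] := mean_value0 t (fun x => is_derive_cos x).
by rewrite normrM ler_piMl // normrN ler_norml sin_geN1 sin_le1.
Qed.

Lemma sin_lip (t : R) : `|sin t| <= `|t|.
Proof.
rewrite -[sin t]subr0 -sin0; have [c _ ->] := mean_value0 t (fun x => is_derive_sin x).
by rewrite normrM ler_piMl // ler_norml cos_geN1 cos_le1.
Qed.

End Taylor.

(** * Characters of the torus *)

Section Characters.
Variables (R : realType) (n : nat).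
Implicit Types (xi eta : 'rV[int]_n) (x y : 'rV[R]_n).

Definition dotp xi x : R := \sum_j (xi 0 j)%:~R * x 0 j.
Definition expi (t : R) : R[i] := Complex (cos t) (sin t).
Definition echar xi x : R[i] := expi (dotp xi x).

Lemma expiD s t : expi (s + t) = expi s * expi t.
Proof.
apply: complex_ext; rewrite ?cReM ?cImM /= ?cosD ?sinD //.
by rewrite addrC.
Qed.

Lemma expi0 : expi 0 = 1.
Proof. by rewrite /expi cos0 sin0. Qed.

Lemma expiN t : expi (- t) = (expi t)^*%C.
Proof. by rewrite /expi cosN sinN. Qed.

Lemma cmod_expi t : cmod (expi t) = 1.
Proof. by rewrite /cmod /= cos2Dsin2 sqrtr1. Qed.

Lemma expi_taylor t : cmod (expi t - 1 - 'i%C * t%:C%C) <= 2 * t ^+ 2.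
Proof.
rewrite (le_trans (cmod_le_ReIm _)) // mulr_natl mulr2n lerD //.
- by rewrite !cReD !cReN cReM /= mul0r mulr0 subrr subr0 cos_sub1_le.
- by rewrite !cImD !cImN cImM /= mul0r mul1r add0r subr0 sin_sub_le.
Qed.

Lemma expi_lip t : cmod (expi t - 1) <= 2 * `|t|.
Proof.
rewrite (le_trans (cmod_le_ReIm _)) // mulr_natl mulr2n lerD //.
- by rewrite !cReD !cReN cos_sub1_lip.
- by rewrite !cImD !cImN /= subr0 sin_lip.
Qed.

Lemma expi_2pi (k : int) : expi (2 * pi * k%:~R) = 1.
Proof.
have e1 : expi (2 * pi) = 1.
  by rewrite /expi mulr_natl -[_ *+ 2]add0r cosD2pi sinD2pi cos0 sin0.
have en (m : nat) : expi (2 * pi * m%:R) = 1.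
  elim: m => [|m ih]; first by rewrite mulr0 expi0.
  by rewrite -[m.+1%:R]natr1 [X in expi X]mulrDr mulr1 expiD ih e1 mulr1.
case: k => m; first exact: en.
by rewrite NegzE mulrNz mulrN expiN en conjc1.
Qed.

Lemma dotpD xi x y : dotp xi (x + y) = dotp xi x + dotp xi y.
Proof. by rewrite -big_split; apply: eq_bigr => j _; rewrite mxE mulrDr. Qed.

Lemma dotp_edir xi (h : R) j : dotp xi (h *: edir R j) = h * (xi 0 j)%:~R.
Proof.
rewrite /dotp (bigD1 j) //= big1 => [|i ne].
  by rewrite addr0 !mxE !eqxx /= mulr1 mulrC.
by rewrite !mxE (negbTE ne) andbF mulr0 mulr0.
Qed.

Lemma echarxD xi x y : echar xi (x + y) = echar xi x * echar xi y.
Proof. by rewrite /echar dotpD expiD. Qed.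

Lemma echarD xi eta x : echar (xi + eta) x = echar xi x * echar eta x.
Proof.
rewrite /echar -expiD; congr expi; rewrite -big_split.
by apply: eq_bigr => j _; rewrite mxE intrD mulrDl.
Qed.

Lemma dotpN xi x : dotp (- xi) x = - dotp xi x.
Proof. by rewrite -sumrN; apply: eq_bigr => j _; rewrite mxE mulrNz mulNr. Qed.

Lemma echarN xi x : echar (- xi) x = (echar xi x)^*%C.
Proof. by rewrite /echar dotpN expiN. Qed.

Lemma echar0 x : echar 0 x = 1.
Proof.
rewrite /echar (_ : dotp 0 x = 0) ?expi0 // /dotp big1 // => j _.
by rewrite mxE mul0r.
Qed.

Lemma echar_mulN xi x : echar xi x * echar (- xi) x = 1.
Proof. by rewrite -echarD subrr echar0. Qed.

Lemma cmod_echar xi x : cmod (echar xi x) = 1.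
Proof. exact: cmod_expi. Qed.

Lemma bdd_echar xi : bdd (echar xi).
Proof. by exists 1 => x; rewrite cmod_echar. Qed.

Lemma echar_periodic xi : periodic2pi (echar xi).
Proof.
move=> x k; rewrite echarxD /echar [X in _ * expi X](_ : _ = 2 * pi * (\sum_j xi 0 j * k 0 j)%:~R).
  by rewrite expi_2pi mulr1.
rewrite /dotp rmorph_sum /= mulr_sumr; apply: eq_bigr => j _.
by rewrite !mxE intrM; ring.
Qed.

Lemma echar_taylor xi x (h : R) j :
  cmod (echar xi (x + h *: edir R j) - echar xi x
        - h%:C%C * ('i%C * (xi 0 j)%:~R * echar xi x))
    <= 2 * (h * (xi 0 j)%:~R) ^+ 2.
Proof.
rewrite echarxD /echar dotp_edir.
set t := h * _; set e := expi (dotp _ _).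
have -> : e * expi t - e - h%:C%C * ('i%C * (xi 0 j)%:~R * e) =
   e * (expi t - 1 - 'i%C * t%:C%C).
  by rewrite /t rmorphM rmorph_int /=; ring.
by rewrite cmodM cmod_expi mul1r expi_taylor.
Qed.

Lemma echar_lip xi x y : cmod (echar xi y - echar xi x) <= 2 * `|dotp xi (y - x)|.
Proof.
have -> : echar xi y = echar xi x * echar xi (y - x).
  by rewrite -echarxD addrC subrK.
rewrite -{2}[echar xi x]mulr1 -mulrBr cmodM cmod_echar mul1r.
exact: expi_lip.
Qed.

Lemma uderiv_echar xi j :
  uderiv j (echar xi) (fun x => 'i%C * (xi 0 j)%:~R * echar xi x).
Proof.
split; [exact: bdd_echar|exact/bddZ/bdd_echar|].
exists (2 * ((xi 0 j)%:~R) ^+ 2) => x h _.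
by rewrite (le_trans (echar_taylor _ _ _ _)) // exprMn mulrA mulrAC.
Qed.

End Characters.

(** * Fourier series with rapidly decaying coefficients *)

Section LatticeSums.
Variables (R : realType) (n : nat).
Local Notation Z := 'rV[int]_n.
Implicit Types (g : Z -> R[i]) (xi : Z).

(** A product over coordinates, so that its sum over a box factors into one-dimensional sums. *)
Definition wt xi : R := \prod_j (1 + (xi 0 j)%:~R ^+ 2)^-1.

Lemma wt_ge0 xi : 0 <= wt xi.
Proof. by apply: prodr_ge0 => j _; rewrite invr_ge0 addr_ge0 ?sqr_ge0. Qed.

Lemma wt0 : wt 0 = 1.
Proof. by rewrite /wt big1 // => j _; rewrite mxE expr0n addr0 invr1. Qed.

Lemma wt_bound_ge0 (g : Z -> R[i]) C : (forall xi, cmod (g xi) <= C * wt xi) -> 0 <= C.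
Proof. by move/(_ 0); rewrite wt0 mulr1; exact: le_trans (cmod_ge0 _). Qed.

(** Series over the lattice follow its numbering by [pickle]; numbers that encode no lattice point
    contribute 0. *)
Definition enum_term (V : nmodType) (g : Z -> V) (k : nat) : V := oapp g 0 (pickle_inv k).

Lemma sum_inv_sqr_le K : \sum_(k < K) (1 + (k%:R : R) ^+ 2)^-1 <= 3.
Proof.
(* Telescoping: for [x >= 1] the term [(1 + x ^+ 2)^-1] is at most [2 / x - 2 / (x + 1)]. The
   subtracted tail makes the induction close. *)
suff H : \sum_(k < K.+1) (1 + (k%:R : R) ^+ 2)^-1 <= 3 - 2 * K.+1%:R^-1.
  rewrite (le_trans (y := \sum_(k < K.+1) (1 + (k%:R : R) ^+ 2)^-1)) //.
    by rewrite big_ord_recr /= lerDl invr_ge0 addr_ge0 ?sqr_ge0.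
  by rewrite (le_trans H) // gerBl mulr_ge0.
elim: K => [|K ih].
  by rewrite big_ord1 /= expr0n addr0 invr1; lra.
rewrite big_ord_recr /= (le_trans (lerD ih (lexx _))) //.
have K0 : 0 < K.+1%:R :> R by rewrite ltr0n.
rewrite -[K.+2%:R]natr1; set x := K.+1%:R in K0 *.
have : (1 + x ^+ 2)^-1 <= 2 * x^-1 - 2 * (x + 1)^-1.
  have -> : 2 * x^-1 - 2 * (x + 1)^-1 = (x * (x + 1) / 2)^-1.
    by field; rewrite !gt_eqF // ltr_wpDr.
  rewrite lef_pV2 ?posrE ?divr_gt0 ?mulr_gt0 ?addr_gt0 ?exprn_gt0 //.
  have : 1 <= x by rewrite ler1n.
  nra.
move: (1 + x ^+ 2)^-1 x^-1 (x + 1)^-1 => a b c; lra.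
Qed.

(* The map [bool * 'I_K -> int] hits 0 twice; only its surjectivity onto
   [|k| < K] matters. *)
Definition int_box K (r : {ffun 'I_n -> bool * 'I_K}) : Z :=
  \row_j (if (r j).1 then ((r j).2 : nat)%:Z else - ((r j).2 : nat)%:Z).

Lemma int_box_surj K xi : (forall j, (`|xi 0%R j|%N < K)%N) ->
  exists r : {ffun 'I_n -> bool * 'I_K}, int_box r = xi.
Proof.
move=> h; exists [ffun j => (0 <= xi 0 j, Ordinal (h j))].
apply/rowP => j; rewrite !mxE ffunE /=.
case: ifPn => [x0|]; first by rewrite gez0_abs.
by rewrite -ltNge => x0; rewrite ltz0_abs ?opprK.
Qed.

Lemma wt_box_sum K : \sum_(r : {ffun 'I_n -> bool * 'I_K}) wt (int_box r) <= 6 ^+ n.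
Proof.
pose F (j : 'I_n) (s : bool * 'I_K) : R := (1 + ((s.2 : nat)%:R) ^+ 2)^-1.
have -> : \sum_(r : {ffun 'I_n -> bool * 'I_K}) wt (int_box r) = \prod_(j < n) \sum_s F j s.
  rewrite bigA_distr_bigA; apply: eq_bigr => r _; apply: eq_bigr => j _.
  by rewrite /F mxE; case: (r j).1; rewrite ?mulrNz ?sqrrN.
rewrite -[in leRHS](card_ord n) -prodr_const; apply: ler_prod => j _.
rewrite sumr_ge0 => [|s _]; last by rewrite invr_ge0 addr_ge0 ?sqr_ge0.
rewrite -(pair_bigA _ (fun _ (k : 'I_K) => (1 + ((k : nat)%:R) ^+ 2)^-1)) /=.
rewrite big_bool /= (_ : 6 = 3 + 3); last by lra.
by rewrite lerD // sum_inv_sqr_le.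
Qed.

(** The lattice points with code below [N] lie in a common box. Each term is charged to a preimage
    under [int_box]; after the sums are exchanged, each [r] pays for at most one code. *)
Lemma wt_sum_le N : \sum_(k < N) enum_term wt k <= 6 ^+ n.
Proof.
pose K := (\max_(k < N) oapp (fun xi : Z => \max_j `|xi 0%R j|%N) 0%N (pickle_inv k)).+1%N.
rewrite (le_trans _ (wt_box_sum K)) //.
have step (k : 'I_N) : enum_term wt k <=
    \sum_(r : {ffun 'I_n -> bool * 'I_K}) (if (k : nat) == pickle (int_box r) then wt (int_box r) else 0).
  rewrite /enum_term; case E: (pickle_inv k) => [xi|] /=; last first.
    by apply: sumr_ge0 => r _; case: ifP => // _; exact: wt_ge0.
  have [|r hr] := @int_box_surj K xi.
    move=> j; rewrite ltnS (leq_trans _ (leq_bigmax k)) // E /=.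
    by rewrite (leq_trans _ (leq_bigmax j)).
  have ek : pickle xi = k by have := pickle_invK (T := Z) k; rewrite E.
  rewrite (bigD1 r) //= hr ek eqxx lerDl; apply: sumr_ge0 => s _.
  by case: ifP => // _; exact: wt_ge0.
rewrite (le_trans (ler_sum _ (fun k _ => step k))) // exchange_big /=.
apply: ler_sum => r _; rewrite -big_mkcond /= sumr_const.
rewrite -[leRHS]mulr1n ler_wpMn2l ?wt_ge0 //.
apply/card_le1_eqP => k l hk hl; apply/val_inj => /=.
by rewrite (eqP hk) (eqP hl).
Qed.

(** On a [wsummable] family the series converges absolutely, so this is its ordinary sum. *)
Definition lsum g : R[i] := ulim (fun N => \sum_(k < N) enum_term g k).

Definition wsummable g := exists C, forall xi, cmod (g xi) <= C * wt xi.

Lemma partial_lsum_le g C N : (forall xi, cmod (g xi) <= C * wt xi) ->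
  cmod (\sum_(k < N) enum_term g k) <= C * 6 ^+ n.
Proof.
move=> h; have C0 := wt_bound_ge0 h.
rewrite (le_trans (cmod_sum _ _ _)) // (le_trans _ (ler_wpM2l C0 (wt_sum_le N))) //.
rewrite mulr_sumr; apply: ler_sum => k _; rewrite /enum_term.
by case: (pickle_inv k) => [xi|]; rewrite /oapp // mulr0 cmod0.
Qed.

Lemma wsummable_bdd g : wsummable g -> bdd (fun N => \sum_(k < N) enum_term g k).
Proof. by move=> [C h]; exists (C * 6 ^+ n) => N; exact: partial_lsum_le. Qed.

Lemma cmod_lsum g C : (forall xi, cmod (g xi) <= C * wt xi) ->
  cmod (lsum g) <= 2 * (C * 6 ^+ n).
Proof. by move=> h; apply: cmod_ulim => N; exact: partial_lsum_le. Qed.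

Lemma enum_term_lin (c : R[i]) g1 g2 k :
  enum_term (fun xi => c * g1 xi + g2 xi) k = c * enum_term g1 k + enum_term g2 k.
Proof. by rewrite /enum_term; case: (pickle_inv k) => //=; rewrite mulr0 addr0. Qed.

Lemma lsum_lin (c : R[i]) g1 g2 : wsummable g1 -> wsummable g2 ->
  lsum (fun xi => c * g1 xi + g2 xi) = c * lsum g1 + lsum g2.
Proof.
move=> /wsummable_bdd s1 /wsummable_bdd s2; rewrite /lsum -ulimZ // -ulimD //; last exact: bddZ.
congr ulim; apply/funext => N; rewrite mulr_sumr -big_split /=.
by apply: eq_bigr => k _; exact: enum_term_lin.
Qed.

Lemma lsum_fin g N0 : (forall xi, (N0 <= pickle xi)%N -> g xi = 0) ->
  lsum g = \sum_(k < N0) enum_term g k.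
Proof.
move=> h; rewrite /lsum -[RHS]ulim_cst; apply: (@ulim_near _ _ _ N0) => N hN.
rewrite -!(big_mkord xpredT) /= (big_cat_nat (n := N0)) //= [X in _ + X]big1_seq ?addr0 //.
move=> k; rewrite mem_index_iota => /andP[_ /andP[hk _]].
rewrite /enum_term; case E: (pickle_inv k) => [xi|] //=; apply: h.
by have := pickle_invK (T := Z) k; rewrite E /= => ->.
Qed.

Lemma lsum_delta g eta : (forall xi, xi != eta -> g xi = 0) -> lsum g = g eta.
Proof.
move=> h; rewrite (@lsum_fin _ (pickle eta).+1) => [|xi hxi]; last first.
  by apply: h; apply: contraTneq hxi => ->; rewrite ltnn.
rewrite big_ord_recr /= /enum_term pickleK_inv /= big1 ?add0r // => k _.
case E: (pickle_inv k) => [xi|] //=; apply: h.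
have := pickle_invK (T := Z) k; rewrite E /= => ek.
by apply/eqP => exi; have := ltn_ord k; rewrite -[X in (X < _)%N]ek exi ltnn.
Qed.

End LatticeSums.

(** * Regularity of sums of characters *)

Section Synthesis.
Variables (R : realType) (n : nat).
Local Notation Z := 'rV[int]_n.
Local Notation Re := (@complex.Re R).
Local Notation Im := (@complex.Im R).
Implicit Types (a b : Z -> R[i]) (xi eta : Z) (x y : 'rV[R]_n).

Definition bracket xi : R := 1 + enorm R xi.

Lemma enorm_ge0 xi : 0 <= enorm R xi. Proof. exact: sqrtr_ge0. Qed.

Lemma enormN xi : enorm R (- xi) = enorm R xi.
Proof.
by rewrite /enorm; congr Num.sqrt; apply: eq_bigr => j _; rewrite mxE mulrNz sqrrN.
Qed.

Lemma sqr_coord_le xi j : (xi 0 j)%:~R ^+ 2 <= enorm R xi ^+ 2.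
Proof.
rewrite sqr_sqrtr; last by apply: sumr_ge0 => i _; rewrite sqr_ge0.
by rewrite (bigD1 j) //= lerDl sumr_ge0 // => i _; rewrite sqr_ge0.
Qed.

Lemma coord_le_enorm xi j : `|(xi 0 j)%:~R : R| <= enorm R xi.
Proof.
rewrite -(@ler_pXn2r _ 2) ?nnegrE ?enorm_ge0 //.
by rewrite real_normK ?num_real // sqr_coord_le.
Qed.

Lemma enorm_le_sum xi : enorm R xi <= \sum_j `|(xi 0 j)%:~R : R|.
Proof.
have s0 : 0 <= \sum_j `|(xi 0 j)%:~R : R| by apply: sumr_ge0.
rewrite -(@ler_pXn2r _ 2) ?nnegrE ?enorm_ge0 //.
rewrite sqr_sqrtr; last by apply: sumr_ge0 => i _; rewrite sqr_ge0.
rewrite expr2 mulr_suml; apply: ler_sum => j _.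
rewrite -real_normK ?num_real // expr2 ler_wpM2l //.
by rewrite (bigD1 j) //= lerDl sumr_ge0.
Qed.

Lemma bracket_ge1 xi : 1 <= bracket xi.
Proof. by rewrite lerDl enorm_ge0. Qed.

Lemma bracket_gt0 xi : 0 < bracket xi.
Proof. exact: lt_le_trans ltr01 (bracket_ge1 xi). Qed.

Lemma bracket_ge0 xi : 0 <= bracket xi.
Proof. exact/ltW/bracket_gt0. Qed.

Lemma bracketX_ge0 xi p : 0 <= bracket xi ^+ p.
Proof. by rewrite exprn_ge0 ?bracket_ge0. Qed.

Lemma coord_le_bracket xi j : `|(xi 0 j)%:~R : R| <= bracket xi.
Proof. by rewrite (le_trans (coord_le_enorm _ _)) // lerDr. Qed.

Lemma bracketN xi : bracket (- xi) = bracket xi.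
Proof. by rewrite /bracket enormN. Qed.

(** Each factor [1 + xi_j ^+ 2] is at most the squared bracket. Hence [2 * n] powers of decay are
    the price of summability. *)
Lemma bracket_pow_wt xi : 1 <= wt R xi * bracket xi ^+ (2 * n).
Proof.
have P0 j : 0 < 1 + ((xi 0 j)%:~R : R) ^+ 2 by rewrite ltr_wpDr ?sqr_ge0.
rewrite exprM -[X in _ ^+ X](card_ord n) -prodr_const -big_split /=.
rewrite [leLHS](_ : _ = \prod_(j < n) 1); last by rewrite big1.
rewrite ler_prod // => j _.
rewrite ler01 /= ler_pdivlMl // mulr1 /bracket sqrrD expr1n mul1r -addrA lerD2l.
by rewrite (le_trans (sqr_coord_le xi j)) // lerDr mulrn_wge0 ?enorm_ge0.
Qed.

Definition rapid a := forall p, exists C, forall xi, cmod (a xi) * bracket xi ^+ p <= C.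

Lemma rapid_poly a b K p : rapid a ->
  (forall xi, cmod (b xi) <= K * bracket xi ^+ p * cmod (a xi)) -> rapid b.
Proof.
move=> ra hb q; have [C hC] := ra (p + q)%N; exists (`|K| * C) => xi.
have b0 := bracket_gt0 xi.
rewrite (le_trans (ler_wpM2r _ (hb xi))) ?bracketX_ge0 //.
rewrite [leLHS](_ : _ = K * (cmod (a xi) * bracket xi ^+ (p + q))); last first.
  by rewrite exprD; ring.
have h0 : 0 <= cmod (a xi) * bracket xi ^+ (p + q).
  by rewrite mulr_ge0 ?cmod_ge0 ?bracketX_ge0.
by rewrite (le_trans (ler_wpM2r h0 (ler_norm K))) // ler_wpM2l.
Qed.

Lemma rapid_wsummable a : rapid a -> wsummable a.
Proof.
move=> /(_ (2 * n)%N) [C hC]; exists C => xi.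
have w0 := wt_ge0 R xi.
rewrite (le_trans _ (ler_wpM2r w0 (hC xi))) // -mulrA ler_peMr ?cmod_ge0 //.
by rewrite mulrC bracket_pow_wt.
Qed.

Lemma rapid_lin (c : R[i]) a b : rapid a -> rapid b ->
  rapid (fun xi => c * a xi + b xi).
Proof.
move=> ra rb p; have [C hC] := ra p; have [D hD] := rb p.
exists (cmod c * C + D) => xi; have b0 := bracket_gt0 xi.
rewrite (le_trans (ler_wpM2r _ (cmodD _ _))) ?bracketX_ge0 // mulrDl lerD //.
by rewrite cmodM -mulrA ler_wpM2l ?cmod_ge0.
Qed.

Lemma rapid_finite a N0 : (forall xi, (N0 <= pickle xi)%N -> a xi = 0) -> rapid a.
Proof.
move=> h p; pose F := fun xi => cmod (a xi) * bracket xi ^+ p.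
have F0 xi : 0 <= F xi by rewrite mulr_ge0 ?cmod_ge0 ?bracketX_ge0.
exists (\sum_(k < N0) enum_term F k) => xi.
have E0 k : 0 <= enum_term F k by rewrite /enum_term; case: pickle_inv.
have [hx|hx] := leqP N0 (pickle xi).
  by rewrite h // cmod0 mul0r sumr_ge0.
rewrite (bigD1 (Ordinal hx)) //= {1}/enum_term pickleK_inv /= lerDl.
by rewrite sumr_ge0.
Qed.

Lemma rapid_eq a eta : (forall xi, xi != eta -> a xi = 0) -> rapid a.
Proof.
move=> h; apply: (@rapid_finite _ (pickle eta).+1) => xi hxi; apply: h.
by apply: contraTneq hxi => ->; rewrite ltnn.
Qed.

Definition dmul (j : 'I_n) a : Z -> R[i] := fun xi => 'i%C * (xi 0 j)%:~R * a xi.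

Lemma rapid_dmul j a : rapid a -> rapid (dmul j a).
Proof.
move=> ra; apply: (@rapid_poly a _ 1 1) => // xi.
rewrite mul1r expr1 !cmodM cmod_i mul1r ler_wpM2r ?cmod_ge0 // cmod_int.
exact: coord_le_bracket.
Qed.

Definition synth a x : R[i] := lsum (fun xi => a xi * echar xi x).

Lemma rapid_echar a x : rapid a -> rapid (fun xi => a xi * echar xi x).
Proof.
move=> ra; apply: (@rapid_poly a _ 1 0) => // xi.
by rewrite cmodM cmod_echar expr0 !mul1r mulr1.
Qed.

Lemma synth_lin (c : R[i]) a b : rapid a -> rapid b ->
  synth (fun xi => c * a xi + b xi) = fun x => c * synth a x + synth b x.
Proof.
move=> ra rb; apply/funext => x; rewrite /synth.
under [in LHS]eq_fun do rewrite mulrDl -mulrA.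
by rewrite lsum_lin //; apply/rapid_wsummable/rapid_echar.
Qed.

Lemma lsum0 : @lsum R n (fun=> 0) = 0.
Proof. by rewrite (@lsum_delta _ _ _ (0 : Z)). Qed.

Lemma rapid0 : rapid (fun=> 0).
Proof. by move=> p; exists 0 => xi; rewrite cmod0 mul0r. Qed.

Lemma synth0 : synth (fun=> 0) = fun=> 0.
Proof.
by apply/funext => x; rewrite /synth; under eq_fun do rewrite mul0r; exact: lsum0.
Qed.

Lemma synth_sum (I : Type) (s : seq I) (P : pred I) (c : I -> R[i]) (F : I -> Z -> R[i]) :
  (forall i, rapid (F i)) ->
  rapid (fun xi => \sum_(i <- s | P i) c i * F i xi) /\
  synth (fun xi => \sum_(i <- s | P i) c i * F i xi) =
    (fun x => \sum_(i <- s | P i) c i * synth (F i) x).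
Proof.
move=> rF; elim: s => [|i s [ih1 ih2]].
  split; first by under eq_fun do rewrite big_nil; exact: rapid0.
  under eq_fun do rewrite big_nil; rewrite synth0.
  by apply/funext => x; rewrite big_nil.
case Pi: (P i).
  have E : (fun xi => \sum_(k <- i :: s | P k) c k * F k xi) =
      (fun xi => c i * F i xi + \sum_(k <- s | P k) c k * F k xi).
    by apply/funext => xi; rewrite big_cons Pi.
  rewrite E; split; first exact: rapid_lin.
  by rewrite synth_lin // ih2; apply/funext => x; rewrite big_cons Pi.
have E : (fun xi => \sum_(k <- i :: s | P k) c k * F k xi) =
    (fun xi => \sum_(k <- s | P k) c k * F k xi).
  by apply/funext => xi; rewrite big_cons Pi.
by rewrite E; split => //; rewrite ih2; apply/funext => x; rewrite big_cons Pi.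
Qed.

Lemma cmod_synth a C x : (forall xi, cmod (a xi) <= C * wt R xi) ->
  cmod (synth a x) <= 2 * (C * 6 ^+ n).
Proof.
by move=> h; apply: cmod_lsum => xi; rewrite cmodM cmod_echar mulr1.
Qed.

Lemma bdd_synth a : rapid a -> bdd (synth a).
Proof.
by move=> /rapid_wsummable [C h]; exists (2 * (C * 6 ^+ n)) => x; exact: cmod_synth.
Qed.

Lemma synth_periodic a : periodic2pi (synth a).
Proof.
move=> x k; rewrite /synth; congr lsum; apply/funext => xi.
by rewrite echar_periodic.
Qed.

Lemma synth_delta a eta : (forall xi, xi != eta -> a xi = 0) ->
  synth a = fun x => a eta * echar eta x.
Proof.
move=> h; apply/funext => x; rewrite /synth (@lsum_delta _ _ _ eta) // => xi ne.
by rewrite h // mul0r.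
Qed.

(** The Taylor remainder of a character is at most 2 h^2 xi_j^2, and applying [dmul j] twice shows
    that xi_j^2 times the coefficients is still summable. The remainder of the series is therefore
    uniform in [x]. *)
Lemma uderiv_synth j a : rapid a -> uderiv j (synth a) (synth (dmul j a)).
Proof.
move=> ra; have rd := rapid_dmul j ra.
split; [exact: bdd_synth|exact: bdd_synth|].
have [C hC] := rapid_wsummable (rapid_dmul j rd).
exists (2 * (2 * C * 6 ^+ n)) => x h _.
have s1 y : wsummable (fun xi => a xi * echar xi y).
  exact/rapid_wsummable/rapid_echar.
have s2 y : wsummable (fun xi => dmul j a xi * echar xi y).
  exact/rapid_wsummable/rapid_echar.
have s3 : wsummable (fun xi => - 1 * (a xi * echar xi x) + a xi * echar xi (x + h *: edir R j)).
  by apply/rapid_wsummable/rapid_lin; exact: rapid_echar.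
have -> : synth a (x + h *: edir R j) - synth a x - h%:C%C * synth (dmul j a) x =
   lsum (fun xi => - h%:C%C * (dmul j a xi * echar xi x) +
     (- 1 * (a xi * echar xi x) + a xi * echar xi (x + h *: edir R j))).
  by rewrite lsum_lin // lsum_lin // /synth; ring.
rewrite (_ : _ * _ = 2 * (2 * C * h ^+ 2 * 6 ^+ n)); last by ring.
apply: cmod_lsum => xi.
have -> : - h%:C%C * (dmul j a xi * echar xi x) +
     (- 1 * (a xi * echar xi x) + a xi * echar xi (x + h *: edir R j)) =
  a xi * (echar xi (x + h *: edir R j) - echar xi x
     - h%:C%C * ('i%C * (xi 0 j)%:~R * echar xi x)).
  by rewrite /dmul; ring.
rewrite cmodM (le_trans (ler_wpM2l (cmod_ge0 _) (echar_taylor _ _ _ _))) //.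
rewrite exprMn (_ : _ * (2 * _) = 2 * h ^+ 2 * (cmod (a xi) * (xi 0 j)%:~R ^+ 2)); last by ring.
rewrite [leRHS](_ : _ = 2 * h ^+ 2 * (C * wt R xi)); last by ring.
apply: ler_wpM2l; first by rewrite mulr_ge0 ?sqr_ge0.
rewrite (le_trans _ (hC xi)) // /dmul !cmodM cmod_i !mul1r cmod_int mulrA -expr2.
by rewrite real_normK ?num_real // mulrC.
Qed.

Lemma coord_le_norm x j : `|x 0 j| <= `|x|.
Proof.
rewrite [leRHS]/Num.Def.normr /= mx_normrE.
exact: (@le_bigmax _ R _ 0 (fun i : 'I_1 * 'I_n => `|x i.1 i.2|) (0, j)).
Qed.

(** The Lipschitz constant of a character grows linearly with the frequency, which rapid decay
    absorbs. *)
Lemma synth_lipschitz a : rapid a ->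
  exists2 L, 0 <= L & forall x y, cmod (synth a y - synth a x) <= L * `|y - x|.
Proof.
move=> ra; have rs : rapid (fun xi => (\sum_j `|(xi 0 j)%:~R : R|)%:C%C * a xi).
  apply: (@rapid_poly a _ n%:R 1) => // xi.
  rewrite cmodM cmod_real ger0_norm ?sumr_ge0 // ler_wpM2r ?cmod_ge0 // expr1.
  rewrite (le_trans (ler_sum _ (fun j _ => coord_le_bracket xi j))) //.
  by rewrite sumr_const card_ord mulr_natl.
have [C hC] := rapid_wsummable rs.
have C0 := wt_bound_ge0 hC.
exists (2 * (2 * C * 6 ^+ n)); first by rewrite !mulr_ge0 ?exprn_ge0.
move=> x y.
have -> : synth a y - synth a x =
   lsum (fun xi => - 1 * (a xi * echar xi x) + a xi * echar xi y).
  rewrite lsum_lin; try exact/rapid_wsummable/rapid_echar.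
  by rewrite /synth; ring.
rewrite [leRHS](_ : _ = 2 * (2 * C * `|y - x| * 6 ^+ n)); last by ring.
apply: cmod_lsum => xi.
rewrite [X in cmod X](_ : _ = a xi * (echar xi y - echar xi x)); last by ring.
rewrite cmodM (le_trans (ler_wpM2l (cmod_ge0 _) (echar_lip _ _ _))) //.
rewrite [leRHS](_ : _ = 2 * (C * wt R xi * `|y - x|)); last by ring.
rewrite mulrCA ler_wpM2l // (le_trans _ (ler_wpM2r (normr_ge0 (y - x)) (hC xi))) //.
have s0 : 0 <= \sum_j `|(xi 0 j)%:~R : R| by apply: sumr_ge0.
rewrite [in leRHS]cmodM cmod_real (ger0_norm s0) [leRHS]mulrAC [leRHS]mulrC.
apply: ler_wpM2l; first exact: cmod_ge0.
rewrite /dotp (le_trans (ler_norm_sum _ _ _)) // mulr_suml; apply: ler_sum => j _.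
by rewrite normrM ler_wpM2l // coord_le_norm.
Qed.

Lemma lipschitz_continuous (phi : 'rV[R]_n -> R) L : 0 <= L ->
  (forall x y, `|phi y - phi x| <= L * `|y - x|) -> continuous phi.
Proof.
move=> L0 h x; apply/(cvgrPdist_le (FF := nbhs_filter x)) => e e0.
have L1 : 0 < L + 1 by rewrite ltr_wpDl.
near=> y; rewrite (le_trans (h _ _)) //.
have : `|x - y| <= e / (L + 1).
  near: y; apply/nbhs_ballP; exists (e / (L + 1)); first exact: divr_gt0.
  move=> y.
  by rewrite mx_norm_ball => /ltW.
rewrite ler_pdivlMr // mulrC; apply: le_trans.
by rewrite mulrDl lerDl mul1r.
Unshelve. all: by end_near. Qed.

Lemma synth_continuous a : rapid a ->
  continuous (Re \o synth a) /\ continuous (Im \o synth a).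
Proof.
move=> /synth_lipschitz [L L0 h]; split; apply: (@lipschitz_continuous _ L L0) => x y; rewrite /comp.
  by rewrite -cReN -cReD (le_trans (cmod_Re _)).
by rewrite -cImN -cImD (le_trans (cmod_Im _)).
Qed.

Lemma cvg_quotient (phi : 'rV[R]_n -> R) x (v : 'rV[R]_n) (d K : R) :
  (forall h : R, `|h| <= 1 -> `|phi (x + h *: v) - phi x - h * d| <= K * h ^+ 2) ->
  h^-1 *: ((phi \o shift x) (h *: v) - phi x) @[h --> 0^'] --> d.
Proof.
move=> hK; apply/cvgrPdist_le => e e0.
have K1 : 0 < `|K| + 1 by rewrite ltr_wpDl.
near=> h => /=.
have hn0 : h != 0 by near: h; exact: nbhs_dnbhs_neq.
have h1 : `|h| <= 1.
  by near: h; apply: dnbhs0_le; exact: ltr01.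
have he : `|h| <= e / (`|K| + 1).
  by near: h; apply: dnbhs0_le; exact: divr_gt0.
have hp : 0 < `|h| by rewrite normr_gt0.
have -> : d - h^-1 *: (phi (h *: v + x) - phi x) =
    - (h^-1 * (phi (x + h *: v) - phi x - h * d)).
  rewrite [h *: v + x]addrC /GRing.scale /=; field.
  exact: hn0.
rewrite normrN normrM normfV ler_pdivrMl // (le_trans (hK h h1)) //.
rewrite -real_normK ?num_real // expr2 mulrCA ler_wpM2l //.
rewrite ler_pdivlMr // in he; rewrite (le_trans _ he) // mulrC ler_wpM2l //.
by rewrite (le_trans (ler_norm K)) // lerDl.
Unshelve. all: by end_near. Qed.

End Synthesis.

(** * Weight sequences *)

Section Weights.
Variables (R : realType) (M : nat -> R).
Hypothesis hM : weight_sequence M.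

Definition wfact j : R := M j * j`!%:R.

Lemma weight_gt0 j : 0 < M j.
Proof. by case: hM. Qed.

(** Log-convexity makes the ratios [M j.+1 / M j] nondecreasing, and the first ratio is 1. *)
Lemma weight_le j : M j <= M j.+1.
Proof.
case: hM => pos [M0 M1] logc _; elim: j => [|j ih]; first by rewrite M0 M1.
rewrite -(ler_pM2l (pos j.+1)) -expr2 (le_trans (logc j)) //.
by rewrite ler_wpM2r // ltW.
Qed.

Lemma weight_ge1 j : 1 <= M j.
Proof.
elim: j => [|j ih]; last exact: le_trans (weight_le j).
by case: hM => _ [-> _] _ _.
Qed.

Lemma wfact_gt0 j : 0 < wfact j.
Proof. by rewrite mulr_gt0 ?weight_gt0 // ltr0n fact_gt0. Qed.

Lemma wfact_ge1 j : 1 <= wfact j.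
Proof. by rewrite mulr_ege1 ?weight_ge1 // ler1n fact_gt0. Qed.

(** The binomial coefficient is a single term in the expansion of [(1 + 1) ^ (j + k)]. *)
Lemma fact_submul j k : ((j + k)`! <= 2 ^ (j + k) * (j`! * k`!))%N.
Proof.
rewrite -(bin_fact (leq_addr k j)) addKn leq_mul2r; apply/orP; right.
rewrite -[2%N]/(1 + 1)%N expnDn (bigD1 (inord j)) //=.
rewrite inordK ?ltnS ?leq_addr // !exp1n !muln1.
by rewrite leq_addr.
Qed.

Lemma wfact_submul : exists2 H, 1 <= H &
  forall j k, wfact (j + k) <= H ^+ (j + k) * wfact j * wfact k.
Proof.
case: hM => pos _ _ [H H1 hH]; exists (2 * H).
  by rewrite mulr_ege1 // ler1n.
move=> j k; rewrite /wfact.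
have f : ((j + k)`!%:R : R) <= 2 ^+ (j + k) * (j`!%:R * k`!%:R).
  by rewrite -natrX -!natrM ler_nat fact_submul.
rewrite (le_trans (ler_pM (ltW (pos _)) (ler0n _ _) (hH j k) f)) // exprMn.
rewrite le_eqVlt; apply/orP; left; apply/eqP; ring.
Qed.

End Weights.

(** * Coefficient sequences of class M *)

Section Decay.
Variables (R : realType) (n : nat) (M : nat -> R).
Hypothesis hM : weight_sequence M.
Local Notation Z := 'rV[int]_n.
Implicit Types (a b : Z -> R[i]) (xi eta : Z).

Definition mdecay a := exists C h : R, [/\ 0 < C, 0 < h &
  forall xi p, cmod (a xi) * bracket R xi ^+ p <= C * h ^+ p * wfact M p].

Lemma mdecay_rapid a : mdecay a -> rapid a.
Proof. by move=> [C [h [_ _ hC]]] p; exists (C * h ^+ p * wfact M p) => xi. Qed.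

Lemma mdecay_bdd a : mdecay a -> exists C, forall xi, cmod (a xi) <= C.
Proof.
by move=> /mdecay_rapid /(_ 0%N) [C hC]; exists C => xi; have := hC xi; rewrite expr0 mulr1.
Qed.

Lemma mdecay_lin (c : R[i]) a b : mdecay a -> mdecay b ->
  mdecay (fun xi => c * a xi + b xi).
Proof.
move=> [C [h [C0 h0 hC]]] [D [k [D0 k0 hD]]].
have m0 : 0 < Num.max h k by rewrite lt_max h0.
exists (cmod c * C + D), (Num.max h k); split => // [|xi p].
  by rewrite ltr_wpDl // mulr_ge0 ?cmod_ge0 // ltW.
have w0 := ltW (wfact_gt0 hM p).
have lh : h ^+ p <= Num.max h k ^+ p.
  by rewrite lerXn2r ?nnegrE ?(ltW h0) ?(ltW m0) // le_max lexx.
have lk : k ^+ p <= Num.max h k ^+ p.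
  by rewrite lerXn2r ?nnegrE ?(ltW k0) ?(ltW m0) // le_max lexx orbT.
rewrite (le_trans (ler_wpM2r _ (cmodD _ _))) ?bracketX_ge0 // !mulrDl lerD //.
  rewrite cmodM -!mulrA ler_wpM2l ?cmod_ge0 // (le_trans (hC xi p)) // -mulrA.
  by rewrite ler_wpM2l ?ler_wpM2r // (ltW C0).
by rewrite (le_trans (hD xi p)) // -!mulrA ler_wpM2l ?ler_wpM2r // (ltW D0).
Qed.

Lemma mdecay_reflect a : mdecay a -> mdecay (fun xi => (a (- xi))^*%C).
Proof.
move=> [C [h [C0 h0 hC]]]; exists C, h; split => // xi p.
by rewrite cmod_conj -bracketN.
Qed.

(** Decay of order [q + p] pays for [q] powers of the bracket, and submultiplicativity of [wfact]
    confines the cost to the constants. With [q = 0] this is plain comparison. *)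
Lemma mdecay_poly a b K q : mdecay a ->
  (forall xi, cmod (b xi) <= K * bracket R xi ^+ q * cmod (a xi)) -> mdecay b.
Proof.
move=> [C [h [C0 h0 hC]]] hb; have [H H1 hH] := wfact_submul hM.
have H0 := lt_le_trans ltr01 H1; have wq := wfact_gt0 hM q.
have K1 : 0 < `|K| + 1 by rewrite ltr_wpDl.
exists ((`|K| + 1) * (C * (h * H) ^+ q * wfact M q)), (h * H); split.
- by rewrite mulr_gt0 // (mulr_gt0 _ wq) // mulr_gt0 // exprn_gt0 // mulr_gt0.
- exact: mulr_gt0.
move=> xi p; rewrite (le_trans (ler_wpM2r _ (hb xi))) ?bracketX_ge0 //.
rewrite [leLHS](_ : _ = K * (cmod (a xi) * bracket R xi ^+ (q + p))); last first.
  by rewrite exprD; ring.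
have hh : 0 <= cmod (a xi) * bracket R xi ^+ (q + p).
  by rewrite mulr_ge0 ?cmod_ge0 ?bracketX_ge0.
have K2 : K <= `|K| + 1 by rewrite (le_trans (ler_norm K)) // lerDl.
rewrite (le_trans (ler_wpM2r hh K2)) //.
rewrite [leRHS](_ : _ = (`|K| + 1) * (C * h ^+ (q + p) *
    (H ^+ (q + p) * wfact M q * wfact M p))); last by rewrite !exprMn !exprD; ring.
rewrite (ler_wpM2l (ltW K1)) // (le_trans (hC xi _)) //.
by rewrite ler_wpM2l ?hH // mulr_ge0 ?exprn_ge0 ?(ltW C0) ?(ltW h0).
Qed.

(** A ball contains finitely many lattice points, expressed through their codes so that it can be
    combined with the enumeration of the lattice. *)
Lemma pickle_bounded (r : R) : exists N0, forall xi, enorm R xi < r -> (pickle xi < N0)%N.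
Proof.
pose K := Num.Def.archi_bound r.
exists (\max_(s : {ffun 'I_n -> bool * 'I_K}) pickle (int_box s)).+1 => xi hxi.
have h j : (`|xi 0%R j|%N < K)%N.
  have r0 : 0 <= r by rewrite (le_trans (enorm_ge0 _ xi)) // ltW.
  rewrite -(ltr_nat R) (le_lt_trans _ (archi_boundP r0)) // (le_trans _ (ltW hxi)) //.
  by rewrite natr_absz intr_norm; exact: coord_le_enorm.
have [s <-] := int_box_surj h.
by rewrite ltnS (leq_bigmax _).
Qed.

Lemma mdecay_far a r C h : 0 < C -> 0 < h ->
  (forall xi p, r <= enorm R xi -> cmod (a xi) * bracket R xi ^+ p <= C * h ^+ p * wfact M p) ->
  mdecay a.
Proof.
move=> C0 h0 hC; have [N0 hN0] := pickle_bounded r.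
pose A := \sum_(k < N0) enum_term (fun xi => cmod (a xi)) k.
have T0 k : 0 <= enum_term (fun xi : Z => cmod (a xi)) k.
  by rewrite /enum_term; case: pickle_inv => [xi|] //; exact: cmod_ge0.
have A0 : 0 <= A by rewrite sumr_ge0.
(* [A] dominates every modulus in the ball of radius [r], and [1 + |r|] dominates the bracket
   there. *)
exists (C + A), (h + (1 + `|r|)); split.
- by rewrite ltr_wpDr.
- by rewrite ltr_wpDr // addr_ge0.
have k0 : 0 <= h + (1 + `|r|) by rewrite !addr_ge0 // ltW.
move=> xi p; have w0 := wfact_ge1 hM p.
have [hr|hr] := leP r (enorm R xi).
  rewrite (le_trans (hC xi p hr)) // ler_wpM2r ?(le_trans _ w0) //.
  rewrite ler_pM ?exprn_ge0 ?(ltW C0) ?(ltW h0) ?lerDl //.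
  by rewrite lerXn2r ?nnegrE ?(ltW h0) // lerDl addr_ge0.
rewrite -[leLHS]mulr1 ler_pM ?mulr_ge0 ?cmod_ge0 ?bracketX_ge0 //.
rewrite ler_pM ?cmod_ge0 ?bracketX_ge0 //; last first.
  rewrite lerXn2r ?nnegrE ?bracket_ge0 //.
  rewrite /bracket addrCA lerD2l (le_trans (ltW hr)) // (le_trans (ler_norm r)) //.
  by rewrite lerDr (ltW h0).
have lt := hN0 xi hr; rewrite (le_trans (y := A)) ?lerDr ?(ltW C0) //.
rewrite /A (bigD1 (Ordinal lt)) //= {1}/enum_term pickleK_inv /= lerDl.
by rewrite sumr_ge0.
Qed.

Lemma mdecay_finite a N0 : (forall xi, (N0 <= pickle xi)%N -> a xi = 0) -> mdecay a.
Proof.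
(* Being larger than the sum of their norms, [r] excludes every point with code below [N0]. *)
move=> h; pose r : R := \sum_(k < N0) enum_term (@enorm R n) k + 1.
apply: (@mdecay_far a r 1 1) => // xi p hr.
have T0 k : 0 <= enum_term (@enorm R n) k.
  by rewrite /enum_term; case: pickle_inv => [x|] //; exact: enorm_ge0.
rewrite h; first by rewrite cmod0 mul0r expr1n !mul1r ltW ?wfact_gt0.
rewrite leqNgt; apply/negP => lt; move: hr; rewrite leNgt => /negP; apply.
rewrite /r (bigD1 (Ordinal lt)) //= {1}/enum_term pickleK_inv /= -addrA ltrDl.
by rewrite ltr_wpDl // sumr_ge0.
Qed.

End Decay.

(** * Termwise differentiation and membership in the class *)

Section Derivatives.
Variables (R : realType) (n : nat).
Local Notation Z := 'rV[int]_n.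
Local Notation Re := (@complex.Re R).
Local Notation Im := (@complex.Im R).
Implicit Types (a b : Z -> R[i]) (f g : 'rV[R]_n -> R[i]) (x : 'rV[R]_n).

Lemma uderiv_cvg j f g x : uderiv j f g ->
  (h^-1 *: (((Re \o f) \o shift x) (h *: edir R j) - Re (f x)) @[h --> 0^'] --> Re (g x)) /\
  (h^-1 *: (((Im \o f) \o shift x) (h *: edir R j) - Im (f x)) @[h --> 0^'] --> Im (g x)).
Proof.
move=> [_ _ [K hK]]; split.
- apply: (@cvg_quotient _ _ (Re \o f) x (edir R j) _ K) => h h1.
  rewrite (le_trans _ (hK x h h1)) // (le_trans _ (cmod_Re _)) //.
  by rewrite !cReD !cReN cReM /= mul0r subr0.
- apply: (@cvg_quotient _ _ (Im \o f) x (edir R j) _ K) => h h1.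
  rewrite (le_trans _ (hK x h h1)) // (le_trans _ (cmod_Im _)) //.
  by rewrite !cImD !cImN cImM /= mul0r addr0.
Qed.

Lemma uderiv_derivable j f g x : uderiv j f g ->
  derivable (Re \o f) x (delta_mx 0 j) /\ derivable (Im \o f) x (delta_mx 0 j).
Proof. by move=> /(@uderiv_cvg _ _ _ x) [h1 h2]; split; apply: cvgP; eassumption. Qed.

Lemma uderiv_partial j f g : uderiv j f g -> partial j f = g.
Proof.
move=> hd; apply/funext => x; have [h1 h2] := uderiv_cvg x hd.
by rewrite /partial /derive; apply: complex_ext => /=; apply/cvg_lim.
Qed.

Lemma partial_synth j a : rapid a -> partial j (synth a) = synth (dmul j a).
Proof. by move=> ra; exact/uderiv_partial/uderiv_synth. Qed.

Lemma partials_synth s a : rapid a ->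
  rapid (foldr (@dmul R n) a s) /\ partials s (synth a) = synth (foldr (@dmul R n) a s).
Proof.
move=> ra; elim: s => [|j s [ih1 ih2]] //=; split; first exact: rapid_dmul.
by rewrite ih2 partial_synth.
Qed.

Lemma smooth_synth a : rapid a -> smooth (synth a).
Proof.
move=> ra s; have [rs ->] := partials_synth s ra.
have [c1 c2] := synth_continuous rs.
by split => // x j; have [] := uderiv_derivable x (uderiv_synth j rs).
Qed.

Definition ximon (alpha : 'I_n -> nat) (xi : Z) : R[i] :=
  'i%C ^+ mdegree alpha * \prod_(j < n) (xi 0 j)%:~R ^+ alpha j.

Lemma iter_dmul k j a : iter k (dmul j) a = fun xi => ('i%C * (xi 0 j)%:~R) ^+ k * a xi.
Proof.
elim: k => [|k ih]; apply/funext => xi; first by rewrite expr0 mul1r.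
by rewrite iterS ih /dmul exprS !mulrA.
Qed.

Lemma mpartial_synth alpha a : rapid a ->
  rapid (fun xi => ximon alpha xi * a xi) /\
  mpartial alpha (synth a) = synth (fun xi => ximon alpha xi * a xi).
Proof.
move=> ra.
have it k j b : rapid b -> rapid (iter k (dmul j) b) /\
    iter k (partial j) (synth b) = synth (iter k (dmul j) b).
  move=> rb; elim: k => [|k [ih1 ih2]] //=; split; first exact: rapid_dmul.
  by rewrite ih2 partial_synth.
have E (s : seq 'I_n) : let c := fun xi : Z => (\prod_(j <- s) ('i%C * (xi 0 j)%:~R) ^+ alpha j) * a xi in
    rapid c /\ foldr (fun j g => iter (alpha j) (partial j) g) (synth a) s = synth c.
  elim: s => [|j s [ih1 ih2]] /=.
    by under eq_fun do rewrite big_nil mul1r.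
  have [h1 h2] := it (alpha j) j _ ih1.
  have e : (fun xi : Z => (\prod_(i <- j :: s) ('i%C * (xi 0 i)%:~R) ^+ alpha i) * a xi) =
      iter (alpha j) (dmul j) (fun xi : Z => (\prod_(i <- s) ('i%C * (xi 0 i)%:~R) ^+ alpha i) * a xi).
    by rewrite iter_dmul; apply/funext => xi; rewrite big_cons mulrA.
  by rewrite e ih2 h2.
have := E (enum 'I_n); rewrite /=.
have -> // : (fun xi : Z => (\prod_(j <- enum 'I_n) ('i%C * (xi 0 j)%:~R) ^+ alpha j) * a xi) =
   (fun xi => ximon alpha xi * a xi).
apply/funext => xi; congr (_ * _); rewrite big_enum /= /ximon /mdegree -prodrXr -big_split /=.
by apply: eq_bigr => j _; rewrite exprMn.
Qed.

Lemma cmod_ximon alpha xi : cmod (ximon alpha xi) <= bracket R xi ^+ mdegree alpha.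
Proof.
rewrite /ximon cmodM cmodX cmod_i expr1n mul1r cmod_prod /mdegree -prodrXr.
apply: ler_prod => j _; rewrite cmod_ge0 cmodX cmod_int.
by rewrite lerXn2r ?nnegrE ?bracket_ge0 // coord_le_bracket.
Qed.

Lemma diffop_synth m (c : {ffun 'I_n -> 'I_m.+1} -> R[i]) a : rapid a ->
  rapid (fun xi => symbol c xi * a xi) /\
  diffop c (synth a) = synth (fun xi => symbol c xi * a xi).
Proof.
move=> ra.
have rF (alpha : {ffun 'I_n -> 'I_m.+1}) : rapid (fun xi => ximon (bmi alpha) xi * a xi).
  by case: (mpartial_synth (bmi alpha) ra).
have [h1 h2] := synth_sum (index_enum {ffun 'I_n -> 'I_m.+1})
  (fun alpha => (0 < mdegree (bmi alpha) <= m)%N) c rF.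
have E : (fun xi => symbol c xi * a xi) = (fun xi => \sum_(alpha : {ffun 'I_n -> 'I_m.+1} | (0 < mdegree (bmi alpha) <= m)%N)
   c alpha * (ximon (bmi alpha) xi * a xi)).
  apply/funext => xi; rewrite /symbol mulr_suml; apply: eq_bigr => alpha _.
  by rewrite /ximon; ring.
rewrite E; split => //; rewrite h2; apply/funext => x; apply: eq_bigr => alpha _.
by have [_ ->] := mpartial_synth (bmi alpha) ra.
Qed.

Variable M : nat -> R.
Hypothesis hM : weight_sequence M.

(** Summability takes [2 * n] further powers of the bracket; by [wfact_submul] they only change the
    constants, [h] becoming [h * H]. *)
Lemma E_M_synth a : mdecay M a -> E_M M (synth a).
Proof.
move=> ma; have ra := mdecay_rapid ma; split.
- exact: synth_periodic.
- exact: smooth_synth.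
have [H H1 hH] := wfact_submul hM; have H0 := lt_le_trans ltr01 H1.
have [C [h [C0 h0 hC]]] := ma.
pose q := (2 * n)%N.
pose D := 2 * (C * (h * H) ^+ q * wfact M q * 6 ^+ n).
have D0 : 0 < D.
  by rewrite mulr_gt0 // mulr_gt0 ?exprn_gt0 // (mulr_gt0 _ (wfact_gt0 hM q)) // mulr_gt0 // exprn_gt0 // mulr_gt0.
exists D, (h * H); split => //; first exact: mulr_gt0.
move=> alpha x; have [_ ->] := mpartial_synth alpha ra.
set p := mdegree alpha.
rewrite [leRHS](_ : _ = 2 * (C * h ^+ (p + q) * (H ^+ (p + q) * wfact M p * wfact M q) * 6 ^+ n)); last first.
  by rewrite /D !exprMn !exprD /wfact; ring.
apply: cmod_synth => xi; have w0 := wt_ge0 R xi.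
have c0 : 0 <= cmod (a xi) * bracket R xi ^+ p by rewrite mulr_ge0 ?cmod_ge0 ?bracketX_ge0.
rewrite cmodM (le_trans (ler_wpM2r (cmod_ge0 _) (cmod_ximon _ _))) // -/p.
rewrite mulrC (le_trans (y := cmod (a xi) * bracket R xi ^+ (p + q) * wt R xi)) //.
  rewrite exprD mulrA -[leRHS]mulrA -[leLHS]mulr1 ler_wpM2l //.
  by rewrite mulrC bracket_pow_wt.
apply: ler_wpM2r => //; rewrite (le_trans (hC xi _)) //.
by rewrite ler_wpM2l ?hH // mulr_ge0 ?exprn_ge0 ?(ltW C0) ?(ltW h0).
Qed.

End Derivatives.

(** * Fourier coefficients *)

Section FourierCoefficients.
Variables (R : realType) (n : nat).
Local Notation Z := 'rV[int]_n.
Implicit Types (a b : Z -> R[i]) (f g : 'rV[R]_n -> R[i]) (x : 'rV[R]_n) (xi eta : Z).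

Definition fhat f xi : R[i] := mean (fun x => f x * echar (- xi) x).

Lemma int_norm_le_sqr (k : int) : `|k%:~R : R| <= k%:~R ^+ 2.
Proof.
have [->|k0] := eqVneq k 0; first by rewrite normr0 expr0n.
rewrite -real_normK ?num_real // expr2 ler_peMr // -intr_norm ler1z.
by rewrite -gtz0_ge1 normr_gt0.
Qed.

Lemma fhat_lin (c : R[i]) f g xi : bdd f -> bdd g ->
  fhat (fun x => c * f x + g x) xi = c * fhat f xi + fhat g xi.
Proof.
move=> bf bg; rewrite /fhat -mean_lin; try (apply: bddM => //; exact: bdd_echar).
by congr mean; apply/funext => x; ring.
Qed.

(** Integration by parts: the derivative of [f] times a character has mean 0. *)
Lemma fhat_uderiv j f g xi : periodic2pi f -> uderiv j f g ->
  fhat g xi = 'i%C * (xi 0 j)%:~R * fhat f xi.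
Proof.
move=> pf hd; have [bf bg _] := hd; have be := @bdd_echar R n (- xi).
have := uderiv_mean _ (uderivM hd (uderiv_echar R (- xi) j)).
set F := (fun x => g x * _ + _).
have -> : F = (fun x => - ('i%C * (xi 0 j)%:~R) * (f x * echar (- xi) x) + g x * echar (- xi) x).
  by apply/funext => x; rewrite /F mxE mulrNz; ring.
rewrite mean_lin; try exact: bddM.
rewrite -/(fhat _ _) -/(fhat _ _) => /(_ _)/eqP; rewrite addrC mulNr subr_eq0 => H.
by apply/eqP/H => x k; rewrite pf echar_periodic.
Qed.

(** Mean and sum are never interchanged. Once the coefficient at [eta] is split off, the rest [a']
    is the sum over j of (xi_j - eta_j)^2 / |xi - eta|^2 times [a']. Each summand has the form
    [dmul j b - i eta_j b] with [b] rapid, and by [fhat_uderiv] the series of such a difference has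
    coefficient 0 at [eta]. *)
Lemma fhat_synth a eta : rapid a -> fhat (synth a) eta = a eta.
Proof.
move=> ra; pose a' xi := if xi == eta then 0 else a xi.
pose da xi := if xi == eta then a eta else 0.
have rda : rapid da by apply: (@rapid_eq _ _ _ eta) => xi; rewrite /da => /negbTE ->.
have ra' : rapid a'.
  apply: (@rapid_poly _ _ a _ 1 0) => // xi; rewrite mulr1 mul1r /a'.
  by case: eqP => // _; rewrite cmod0 cmod_ge0.
have -> : a = (fun xi => 1 * da xi + a' xi).
  by apply/funext => xi; rewrite /da /a'; case: eqP => [->|_]; rewrite mul1r ?addr0 ?add0r.
rewrite synth_lin // fhat_lin; try exact: bdd_synth.
rewrite (@synth_delta _ _ da eta); last by move=> xi; rewrite /da => /negbTE ->.
rewrite {2}/fhat.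
have -> : fhat (fun x => da eta * echar eta x) eta = da eta.
  rewrite /fhat -[RHS](@mean_cst R n); congr mean; apply/funext => x.
  by rewrite -mulrA echar_mulN mulr1.
rewrite -/(fhat _ _).
suff -> : fhat (synth a') eta = 0 by rewrite /a' eqxx.
pose t j xi : R[i] := (xi 0 j - eta 0 j)%:~R.
pose D xi : R[i] := \sum_j t j xi ^+ 2.
pose b j xi := - 'i%C * t j xi / D xi * a' xi.
have rb j : rapid (b j).
  apply: (@rapid_poly _ _ a' _ 1 0) => // xi; rewrite mulr1 /b cmodM.
  apply: ler_wpM2r; first exact: cmod_ge0.
  pose s i : R := (xi 0 i - eta 0 i)%:~R.
  have -> : D xi = (\sum_i s i ^+ 2)%:C%C.
    by rewrite rmorph_sum; apply: eq_bigr => i _; rewrite rmorphXn /= /s rmorph_int.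
  rewrite !cmodM cmodN cmod_i mul1r cmodV cmod_real cmod_int -/(s j).
  have s0 : 0 <= \sum_i s i ^+ 2 by apply: sumr_ge0 => i _; exact: sqr_ge0.
  rewrite (ger0_norm s0).
  (* The denominator vanishes only at [eta], where the quotient is 0 by convention. *)
  have [->|ns] := eqVneq (\sum_i s i ^+ 2) 0; first by rewrite invr0 mulr0.
  have sp : 0 < \sum_i s i ^+ 2 by rewrite lt_def ns.
  rewrite ler_pdivrMr // mul1r.
  apply: (@le_trans _ _ (s j ^+ 2)); last first.
    by rewrite (bigD1 j) //= lerDl sumr_ge0 // => i _; exact: sqr_ge0.
  exact: int_norm_le_sqr.
pose F j xi := - ('i%C * (eta 0 j)%:~R) * b j xi + dmul j (b j) xi.
have rF j : rapid (F j) by apply: rapid_lin; [exact: rb|exact/rapid_dmul/rb].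
have zF j : fhat (synth (F j)) eta = 0.
  rewrite synth_lin; [|exact: rb|exact/rapid_dmul/rb].
  rewrite fhat_lin; try (apply: bdd_synth; first [exact: rb|exact/rapid_dmul/rb]).
  rewrite (fhat_uderiv _ (@synth_periodic _ _ _) (uderiv_synth j (rb j))); ring.
have Ea : a' = (fun xi => \sum_j 1 * F j xi).
  apply/funext => xi.
  have e j : 1 * F j xi = t j xi ^+ 2 * (a' xi / D xi).
    rewrite /F /b /dmul /t intrB mul1r.
    transitivity (- ('i%C ^+ 2) * ((xi 0 j)%:~R - (eta 0 j)%:~R) ^+ 2 * (a' xi / D xi)).
      by ring.
    by rewrite sqr_i opprK mul1r.
  under eq_bigr do rewrite e; rewrite -mulr_suml -/(D xi).
  have [xe|xe] := eqVneq xi eta; first by rewrite /a' xe eqxx mul0r mulr0.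
  have D0 : D xi != 0.
    apply: contraNneq xe => D0; apply/eqP/rowP => j.
    have : \sum_i ((xi 0 i - eta 0 i) ^+ 2) = 0 :> int.
      apply: (@intr_inj R[i]); rewrite -[RHS]D0 rmorph_sum.
      by apply: eq_bigr => i _; rewrite rmorphXn.
    move/eqP; rewrite psumr_eq0 => [|i _]; last exact: sqr_ge0.
    by move=> /allP /(_ j (mem_index_enum _)); rewrite sqrf_eq0 subr_eq0 => /eqP.
  by rewrite mulrCA divff // mulr1.
have [_ Es] := synth_sum (index_enum 'I_n) xpredT (fun=> 1) rF.
rewrite Ea Es /fhat.
transitivity (mean (fun x => \sum_j synth (F j) x * echar (- eta) x)).
  congr mean; apply/funext => x; rewrite mulr_suml.
  by apply: eq_bigr => j _; rewrite mul1r.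
rewrite mean_sum => [|j]; last by apply: bddM; [exact: bdd_synth|exact: bdd_echar].
by rewrite big1 // => j _; exact: zF.
Qed.

End FourierCoefficients.

(** * The cosine near its maximum *)

Section CosineFacts.
Variable R : realType.

Lemma cos_near1 (e : R) : 0 < e ->
  exists2 c, c < 1 & forall t : R, c < cos t -> exists k : int, `|t - 2 * pi * k%:~R| < e.
Proof.
move=> e0; pose e' := Num.min e 1.
have e'0 : 0 < e' by rewrite lt_min e0 ltr01.
have e'pi : e' <= pi by rewrite (le_trans (y := 1)) ?ge_min ?lexx ?orbT // (le_trans _ (pi_ge2 R)) // ler1n.
have in0 : (0 : R) \in `[0, pi] by rewrite in_itv /= lexx pi_ge0.
have ine : e' \in `[0, pi] by rewrite in_itv /= (ltW e'0).
have p2 : 0 < 2 * pi :> R by rewrite mulr_gt0 ?pi_gt0.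
exists (cos e'); first by rewrite -[ltRHS]cos0 ltr_cos.
(* [k] is the integer nearest to [t / (2 * pi)], so the difference has absolute value at most pi,
   where the cosine is injective and decreasing in that absolute value. *)
move=> t ht; pose k := Num.floor (t / (2 * pi) + 2^-1); exists k.
have /andP[h1 h2] := floor_itv (t / (2 * pi) + 2^-1); rewrite -/k in h1 h2.
set s := t - _.
have es : cos `|s| = cos t.
  have : expi (t - 2 * pi * k%:~R) = expi t.
    by rewrite expiD -mulrN -mulrNz expi_2pi mulr1.
  by rewrite cos_norm => -[].
have hs : `|s| <= pi.
  have et : t = (t / (2 * pi)) * (2 * pi) by rewrite divfK // gt_eqF.
  rewrite /s et; move: (t / (2 * pi)) h1 h2 => u h1 h2.
  rewrite intrD in h2; have pp := pi_gt0 R.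
  rewrite ler_norml; apply/andP; split; nra.
have ins : `|s| \in `[0, pi] by rewrite in_itv /= normr_ge0.
rewrite -es ltr_cos // in ht.
by rewrite (lt_le_trans ht) // ge_min lexx.
Qed.

(** Finitely many rational shifts bring any point near 0 modulo 2 pi; this will cover the torus by
    translates of a small set. *)
Lemma cos_rational_shift (d : R) : 0 < d ->
  exists2 q, (0 < q)%N & forall t : R, exists i : 'I_q, 1 - d <= cos (t + 2 * pi * (i : nat)%:R / q%:R).
Proof.
move=> d0; pose q := (Num.Def.archi_bound (2 * pi / d)).+1; exists q => // t.
have p2 : 0 < 2 * pi :> R by rewrite mulr_gt0 ?pi_gt0.
have q0 : 0 < q%:R :> R by rewrite ltr0n.
have hq : 2 * pi / q%:R <= d.
  rewrite ler_pdivrMr // [leRHS]mulrC -ler_pdivrMr //.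
  have pd : 0 <= 2 * pi / d by rewrite divr_ge0 ?(ltW p2) ?(ltW d0).
  by rewrite (le_trans (ltW (archi_boundP pd))) // ler_nat.
pose u := t * q%:R / (2 * pi); pose m := Num.floor u.
have /andP[h1 h2] := floor_itv u; rewrite -/m in h1 h2.
have qz : (q%:Z : int) != 0 by [].
(* Modulo [q] the shift cancels the integer part of [u], so up to a period only the fractional part
   of [u], scaled by [2 * pi / q], remains. *)
pose i := (- m %% q%:Z)%Z.
have i0 : 0 <= i by rewrite modz_ge0.
have iq : (`|i|%N < q)%N by rewrite -ltz_nat gez0_abs // ltz_pmod.
exists (Ordinal iq) => /=.
have ei : (`|i|%N%:R : R) = (- m - (- m %/ q%:Z)%Z * q%:Z)%:~R.
  by rewrite natr_absz ger0_norm // /i {2}(divz_eq (- m) q%:Z) addrC addKr.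
set k := (- m %/ q%:Z)%Z in ei.
have ->: t + 2 * pi * `|i|%N%:R / q%:R = 2 * pi * (u - m%:~R) / q%:R + 2 * pi * (- k)%:~R.
  rewrite ei /u intrB mulrNz intrM mulrNz -pmulrn.
  move: (2 * pi) (q%:R) (gt_eqF p2) (gt_eqF q0) => P Q P0 Q0.
  by field; rewrite P0 Q0.
set s := 2 * pi * (u - _) / _.
have -> : cos (s + 2 * pi * (- k)%:~R) = cos s.
  by have : expi (s + 2 * pi * (- k)%:~R) = expi s; [rewrite expiD expi_2pi mulr1|case].
have s0 : 0 <= s by rewrite divr_ge0 ?mulr_ge0 ?pi_ge0 // subr_ge0.
have sd : s <= d.
  rewrite (le_trans _ hq) // ler_pM2r ?invr_gt0 //.
  rewrite intrD in h2; nra.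
have := cos_sub1_lip s; rewrite ler_norml ger0_norm // => /andP[h _].
lra.
Qed.

Lemma bernoulli_ineq (x : R) r : 0 <= x -> 1 + r%:R * x <= (1 + x) ^+ r.
Proof.
move=> x0; elim: r => [|r ih]; first by rewrite mul0r addr0 expr0.
have r0 : 0 <= r%:R :> R by [].
rewrite exprS -natr1 (le_trans _ (ler_wpM2l _ ih)) ?addr_ge0 //.
nra.
Qed.

End CosineFacts.

(** * Peaking trigonometric polynomials *)

Section Uniqueness.
Variables (R : realType) (n : nat).
Local Notation Z := 'rV[int]_n.
Local Notation Re := (@complex.Re R).
Local Notation Im := (@complex.Im R).
Implicit Types (f g : 'rV[R]_n -> R[i]) (x : 'rV[R]_n) (xi eta : Z).

Definition orth_all f := bdd f /\ forall xi, mean (fun x => f x * echar xi x) = 0.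

Lemma orth_lin (c : R[i]) f g : orth_all f -> orth_all g -> orth_all (fun x => c * f x + g x).
Proof.
move=> [bf hf] [bg hg]; split; first by apply: bddD => //; exact: bddZ.
move=> xi; have be := @bdd_echar R n xi.
transitivity (mean (fun x => c * (f x * echar xi x) + g x * echar xi x)).
  by congr mean; apply/funext => x; ring.
by rewrite mean_lin ?hf ?hg ?mulr0 ?addr0 //; exact: bddM.
Qed.

Lemma orth_echar eta f : orth_all f -> orth_all (fun x => echar eta x * f x).
Proof.
move=> [bf hf]; split; first by apply: bddM => //; exact: bdd_echar.
move=> xi; rewrite -[RHS](hf (eta + xi)); congr mean; apply/funext => x.
by rewrite echarD; ring.
Qed.

Lemma orth0 : orth_all (fun=> 0).
Proof.
split; first exact: bdd_cst.
by move=> xi; under eq_fun do rewrite mul0r; exact: mean_cst.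
Qed.

Lemma orthZ (c : R[i]) f : orth_all f -> orth_all (fun x => c * f x).
Proof.
by move=> hf; have := orth_lin c hf orth0; under eq_fun do rewrite addr0.
Qed.

Lemma orth_sum (I : Type) (s : seq I) (F : I -> 'rV[R]_n -> R[i]) :
  (forall i, orth_all (F i)) -> orth_all (fun x => \sum_(i <- s) F i x).
Proof.
move=> hF; elim: s => [|i s ih].
  by under eq_fun do rewrite big_nil; exact: orth0.
under eq_fun do rewrite big_cons.
by have := orth_lin 1 (hF i) ih; under eq_fun do rewrite mul1r.
Qed.

Variable x0 : 'rV[R]_n.

Lemma orth_cos j f : orth_all f ->
  orth_all (fun x => (cos (x 0 j - x0 0 j))%:C%C * f x).
Proof.
move=> hf; pose u : Z := delta_mx 0 j.
have du x : dotp u x = x 0 j.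
  rewrite /dotp (bigD1 j) //= big1 => [|i ne].
    by rewrite mxE !eqxx mul1r addr0.
  by rewrite mxE (negbTE ne) andbF mul0r.
have := orth_lin (2^-1 * echar (- u) x0) (orth_echar u hf)
  (orthZ (2^-1 * echar u x0) (orth_echar (- u) hf)).
congr orth_all; apply/funext => x.
rewrite !mulrA -mulrDl; congr (_ * _).
rewrite !echarN /echar !du -!expiN.
transitivity (2^-1 * (expi (x 0 j - x0 0 j) + expi (- (x 0 j - x0 0 j)))).
  by rewrite opprB !expiD; ring.
rewrite expiN; set z := expi _.
have -> : z + z^*%C = 2 * (cos (x 0 j - x0 0 j))%:C%C by rewrite addcJ.
by rewrite mulrA mulVf ?mul1r // pnatr_eq0.
Qed.

(** With this weight the sum in [peak] is at least [- (n / n.+1)], which keeps [peak] nonnegative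
    for [d >= 0], and it loses at most [d / 2] where every cosine is at least [1 - d]. *)
Let w : R := (2 * n.+1%:R)^-1.

Let w0 : 0 < w. Proof. by rewrite invr_gt0 mulr_gt0 // ltr0n. Qed.

(* Rudin's trigonometric polynomial: it exceeds 1 only near [x0] modulo 2 pi. *)
Definition peak (d : R) x : R := 1 + d + \sum_j w * (cos (x 0 j - x0 0 j) - 1).

Lemma orth_peak d f : orth_all f -> orth_all (fun x => (peak d x)%:C%C * f x).
Proof.
move=> hf.
have h j : orth_all (fun x => (w%:C%C * ((cos (x 0 j - x0 0 j))%:C%C * f x) + (- w)%:C%C * f x)).
  by apply: orth_lin; [exact: orth_cos|exact: orthZ].
have := orth_lin (1 + d)%:C%C hf (orth_sum (index_enum 'I_n) h).
congr orth_all; apply/funext => x; rewrite /peak [in RHS]rmorphD [RHS]mulrDl; congr (_ + _).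
rewrite rmorph_sum mulr_suml; apply: eq_bigr => j _.
by rewrite rmorphM rmorphB rmorphN rmorph1 /=; ring.
Qed.

Lemma orth_peakX d f r : orth_all f -> orth_all (fun x => ((peak d x) ^+ r)%:C%C * f x).
Proof.
move=> hf; elim: r => [|r ih].
  by under eq_fun do rewrite expr0 mul1r.
by have := orth_peak d ih; under eq_fun do rewrite mulrA -rmorphM -exprS.
Qed.

Lemma peak_bounds d x : 0 <= d -> 0 <= peak d x <= 1 + d.
Proof.
move=> d0; apply/andP; split; last first.
  rewrite gerDl sumr_le0 // => j _.
  by rewrite pmulr_rle0 // subr_le0 cos_le1.
have : \sum_(j < n) (w * - 2) <= \sum_j w * (cos (x 0 j - x0 0 j) - 1).
  apply: ler_sum => j _; rewrite ler_pM2l //.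
  have := cos_geN1 (x 0 j - x0 0 j); lra.
have -> : \sum_(j < n) (w * - 2) = - (n%:R / n.+1%:R).
  rewrite sumr_const card_ord -[LHS]mulr_natl.
  have N0 : n.+1%:R != 0 :> R by rewrite pnatr_eq0.
  by rewrite /w; move: (n.+1%:R : R) N0 => N N0; field.
move=> h; have : n%:R / n.+1%:R <= 1 :> R.
  by rewrite ler_pdivrMr ?ltr0n // mul1r ler_nat.
move: (n%:R / n.+1%:R) h => a; rewrite /peak; lra.
Qed.

(** This calibrates [d]: one coordinate away from [x0] already costs [w * (1 - c)], so [peak > 1]
    forces all coordinates to be close. *)
Lemma peak_le1 c x j : cos (x 0 j - x0 0 j) <= c -> peak (w * (1 - c)) x <= 1.
Proof.
move=> hc; rewrite /peak (bigD1 j) //=.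
have h : \sum_(i < n | i != j) w * (cos (x 0 i - x0 0 i) - 1) <= 0.
  by apply: sumr_le0 => i _; rewrite pmulr_rle0 // subr_le0 cos_le1.
have : w * (cos (x 0 j - x0 0 j) - 1) <= w * (c - 1) by rewrite ler_pM2l // lerD2r.
lra.
Qed.

Lemma peak_ge d x : 0 <= d -> (forall j, 1 - d <= cos (x 0 j - x0 0 j)) ->
  1 + d / 2 <= peak d x.
Proof.
move=> d0 h.
have : \sum_(j < n) (w * - d) <= \sum_j w * (cos (x 0 j - x0 0 j) - 1).
  apply: ler_sum => j _; rewrite ler_pM2l //.
  have := h j; lra.
have -> : \sum_(j < n) (w * - d) = - (d / 2 * (n%:R / n.+1%:R)).
  rewrite sumr_const card_ord -[LHS]mulr_natl.
  have N0 : n.+1%:R != 0 :> R by rewrite pnatr_eq0.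
  by rewrite /w; move: (n.+1%:R : R) N0 => N N0; field.
move=> h2; have : d / 2 * (n%:R / n.+1%:R) <= d / 2.
  by rewrite ler_piMr ?divr_ge0 // ler_pdivrMr ?ltr0n // mul1r ler_nat.
move: (d / 2 * (n%:R / n.+1%:R)) h2 => a; rewrite /peak; lra.
Qed.

(** Indicator of a neighbourhood of [x0] modulo 2 pi on which the powers of [peak] grow
    geometrically; [mean] acts on every bounded function, so its measure makes sense. *)
Definition peak_set d x : R[i] := if 1 + d / 2 <= peak d x then 1 else 0.

Lemma peak_periodic d x (k : 'rV[int]_n) :
  peak d (x + \row_j (2 * pi * (k 0 j)%:~R)) = peak d x.
Proof.
rewrite /peak; congr (_ + _); apply: eq_bigr => j _; congr (_ * (_ - _)).
have : expi (x 0 j - x0 0 j + 2 * pi * (k 0 j)%:~R) = expi (x 0 j - x0 0 j).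
  by rewrite expiD expi_2pi mulr1.
by rewrite !mxE addrAC => -[].
Qed.

Lemma bdd_peak_set d : bdd (peak_set d).
Proof. by exists 1 => x; rewrite /peak_set; case: ifP; rewrite ?cmod1 ?cmod0. Qed.

(** Finitely many rational translates of the set cover the space and share one mean, so that mean
    times their number is at least 1. *)
Lemma mean_peak_set_gt0 d : 0 < d -> 0 < Re (mean (peak_set d)).
Proof.
move=> d0; have [q q0 hq] := cos_rational_shift d0.
pose sh (s : {ffun 'I_n -> 'I_q}) : 'rV[R]_n := gridv R q (fun j => s j).
have pp : periodic2pi (peak_set d) by move=> x k; rewrite /peak_set peak_periodic.
have cover x : 1 <= Re (\sum_(s : {ffun 'I_n -> 'I_q}) peak_set d (x + sh s)).
  have [s hs] : exists s : {ffun 'I_n -> 'I_q}, forall j, 1 - d <= cos (x 0 j - x0 0 j + 2 * pi * (s j : nat)%:R / q%:R).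
    have [s hs] := choice (fun j => hq (x 0 j - x0 0 j)).
    by exists [ffun j => s j] => j; rewrite ffunE.
  have -> : Re (\sum_(s : {ffun 'I_n -> 'I_q}) peak_set d (x + sh s)) =
      \sum_(s : {ffun 'I_n -> 'I_q}) Re (peak_set d (x + sh s)).
    by elim/big_rec2: _ => // i a b _ <-; rewrite cReD.
  have r0 t : 0 <= Re (peak_set d t) by rewrite /peak_set; case: ifP.
  rewrite (bigD1 s) //= {1}/peak_set peak_ge ?(ltW d0) //=.
    by rewrite lerDl sumr_ge0.
  by move=> j; have := hs j; rewrite !mxE addrAC.
have bs s : bdd (fun x => peak_set d (x + sh s)).
  by apply: bdd_translate; exact: bdd_peak_set.
have := mean_Re_ge (bdd_sum _ _ bs) cover.
rewrite mean_sum //.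
under eq_bigr do rewrite mean_translate //.
rewrite sumr_const -mulr_natl cReM.
have -> : ((#|{: {ffun 'I_n -> 'I_q}}|%:R : R[i])) = (#|{: {ffun 'I_n -> 'I_q}}|%:R : R)%:C%C.
  by rewrite rmorph_nat.
rewrite /= mul0r subr0; set N := #|_|; set m := lim _.
have [m0|//] := leP m 0.
have : N%:R * m <= 0 by rewrite mulr_ge0_le0.
lra.
Qed.

End Uniqueness.

(** * Uniqueness of Fourier coefficients *)

Section Inversion.
Variables (R : realType) (n : nat).
Local Notation Z := 'rV[int]_n.
Local Notation Re := (@complex.Re R).
Local Notation Im := (@complex.Im R).
Implicit Types (f g : 'rV[R]_n -> R[i]) (x : 'rV[R]_n) (xi eta : Z) (a b : Z -> R[i]).

Definition continuous_periodic f :=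
  [/\ bdd f, periodic2pi f, continuous (Re \o f) & continuous (Im \o f)].

(** Rudin's argument: were [f x0] nonzero, the mean of [peak ^+ r] against a multiple of [f], which
    is 0, would grow without bound with [r]. *)
Lemma orth_eq0 f x0 : continuous_periodic f -> orth_all f -> f x0 = 0.
Proof.
move=> [bf pf cR cI] hf; apply/eqP; apply/negPn/negP => f0.
(* The value at [x0] becomes real and positive, so only a real part has to be followed. *)
pose g x := (f x0)^*%C * f x.
have hg : orth_all g by exact: orthZ.
have pg : periodic2pi g by move=> x k; rewrite /g pf.
have eg x : Re (g x) = Re (f x0) * Re (f x) + Im (f x0) * Im (f x).
  by rewrite /g cReM; case: (f x0) => u v /=; rewrite mulNr opprK.
pose p := Re (g x0).
have p0 : 0 < p.
  have : 0 < cmod (f x0) by rewrite cmod_gt0.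
  rewrite /p eg; case: (f x0) f0 => u v; rewrite /cmod /= => _.
  by rewrite sqrtr_gt0 !expr2.
have cg : (fun x => Re (g x)) x @[x --> x0] --> p.
  rewrite /p eg; under eq_fun do rewrite eg.
  have FF := nbhs_filter x0.
  have hR := @cvgMl_tmp R _ (nbhs x0) FF (Re \o f) (Re (f x0)) _ (cR x0).
  have hI := @cvgMl_tmp R _ (nbhs x0) FF (Im \o f) (Im (f x0)) _ (cI x0).
  exact: (@cvgD _ _ _ _ FF _ _ _ _ hR hI).
have p2 : p / 2 < p by lra.
have nb : nbhs x0 [set x | p / 2 <= Re (g x)].
  by have := @cvgr_ge R _ (nbhs x0) (nbhs_filter x0) _ p cg _ p2.
have [e /= e0 he] := proj1 (nbhs_ballP x0 _) nb.
have [c c1 hc] := cos_near1 e0.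
pose w : R := (2 * n.+1%:R)^-1.
have w0 : 0 < w by rewrite invr_gt0 mulr_gt0 // ltr0n.
pose d := w * (1 - c).
have d0 : 0 < d by rewrite mulr_gt0 // subr_gt0.
have near_ge x : 1 < peak x0 d x -> p / 2 <= Re (g x).
  move=> hx; have hj j : exists k : int, `|x 0 j - x0 0 j - 2 * pi * k%:~R| < e.
    apply: hc; rewrite ltNge; apply/negP => /(@peak_le1 _ _ x0).
    by rewrite leNgt hx.
  have [k hk] := choice hj.
  (* Balls are taken in the maximum norm, so each coordinate may be moved near [x0] by its own
     multiple of 2 pi. *)
  rewrite -(pg x (\row_j - k j)); apply: he.
  split=> // i j; rewrite (ord1 i) /ball /= !mxE mulrNz mulrN opprD opprK addrA.
  rewrite -normrN opprD !opprB addrAC.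
  by rewrite (_ : x 0 j - _ - _ = x 0 j - x0 0 j - 2 * pi * (k j)%:~R) //; ring.
have [B hB] : bdd g by exact: bddZ.
have hB' x : - B <= Re (g x).
  by move: (le_trans (cmod_Re (g x)) (hB x)); rewrite ler_norml => /andP[].
have B0 : 0 <= B := le_trans (cmod_ge0 _) (hB x0).
pose s r := p / 2 * (1 + d / 2) ^+ r.
pose V := peak_set x0 d.
have mu0 : 0 < Re (mean V) := mean_peak_set_gt0 x0 d0.
(* Where [V] is 1, the product [peak ^+ r * Re g] is at least [s r]; elsewhere it is nonnegative if
   [peak > 1] and at least [- B] if not. The product has mean 0, so averaging leaves the stated
   bound. *)
have bound r : s r * Re (mean V) <= B.
  pose F x := - (s r)%:C%C * V x + (peak x0 d x ^+ r)%:C%C * g x.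
  have [bF0 mF0] := orth_peakX x0 d r hg.
  have bV : bdd V by exact: bdd_peak_set.
  have bF : bdd F by apply: bddD => //; exact: bddZ.
  have FB x : - B <= Re (F x).
    have /andP[pk0 _] := peak_bounds x0 x (ltW d0).
    have pkr : 0 <= peak x0 d x ^+ r by rewrite exprn_ge0.
    have -> : Re (F x) = - s r * Re (V x) + peak x0 d x ^+ r * Re (g x).
      by rewrite /F cReD !cReM /= oppr0 !mul0r !subr0.
    rewrite /V /peak_set; case: ifP => [hx|_] /=.
      have gx : p / 2 <= Re (g x) by apply: near_ge; rewrite (lt_le_trans _ hx) // ltrDl divr_gt0.
      have : s r <= peak x0 d x ^+ r * Re (g x).
        have d1 : 0 <= 1 + d / 2 by rewrite addr_ge0 // divr_ge0 // ltW.
        rewrite /s mulrC; apply: ler_pM => //; first by rewrite exprn_ge0.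
          by rewrite divr_ge0 // ltW.
        by rewrite lerXn2r ?nnegrE.
      by rewrite mulr1; lra.
    rewrite mulr0 add0r; have [h1|h1] := ltP 1 (peak x0 d x).
      rewrite (le_trans (y := 0)) ?oppr_le0 // mulr_ge0 //.
      by rewrite (le_trans _ (near_ge _ h1)) // divr_ge0 // ltW.
    have pk1 : peak x0 d x ^+ r <= 1 by rewrite exprn_ile1.
    have := hB' x; nra.
  have := mean_Re_ge bF FB; rewrite /F mean_lin //.
  have -> : mean (fun x => (peak x0 d x ^+ r)%:C%C * g x) = 0.
    by rewrite -[RHS](mF0 0); congr mean; apply/funext => x; rewrite echar0 mulr1.
  rewrite addr0 cReM cReN [Re _%:C%C]/= cImN [Im _%:C%C]/= oppr0 mul0r subr0.
  by rewrite mulNr lerN2.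
pose X := B / (p / 2 * (d / 2) * Re (mean V)).
have Y0 : 0 < p / 2 * (d / 2) * Re (mean V).
  by apply: mulr_gt0 => //; apply: mulr_gt0; exact: divr_gt0.
have X0 : 0 <= X by rewrite divr_ge0 // ltW.
have := archi_boundP X0; set r := Num.Def.archi_bound X.
rewrite /X ltr_pdivrMr // => hr.
have := bound r; rewrite leNgt => /negP; apply; rewrite (lt_le_trans hr) //.
have q0 : 0 < p / 2 by rewrite divr_gt0.
rewrite [leLHS](_ : _ = p / 2 * (r%:R * (d / 2)) * Re (mean V)); last by ring.
rewrite (ler_pM2r mu0) /s (ler_pM2l q0).
have d2 : 0 <= d / 2 by rewrite divr_ge0 // ltW.
by rewrite (le_trans _ (bernoulli_ineq r d2)) // lerDr.
Qed.

Lemma fourier_inj f g : continuous_periodic f -> continuous_periodic g ->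
  (forall xi, fhat f xi = fhat g xi) -> f = g.
Proof.
move=> [bf pf fR fI] [bg pg gR gI] h.
pose D x := - 1 * g x + f x.
have bD : bdd D by apply: bddD => //; exact: bddZ.
have oD : orth_all D.
  split=> // xi; have := fhat_lin (- 1) (- xi) bg bf.
  rewrite h mulN1r addNr => <-; rewrite /fhat; congr mean; apply/funext => x.
  by rewrite opprK.
apply/funext => x0; apply/eqP; rewrite -subr_eq0 -[_ - _]addrC -mulN1r; apply/eqP.
apply: (@orth_eq0 D x0) => //; split => //.
- by move=> x k; rewrite /D pf pg.
- move=> x; have -> : Re \o D = (fun x => - Re (g x) + Re (f x)).
    by apply/funext => y; rewrite /comp /D mulN1r cReD cReN.
  have FF := nbhs_filter x.
  exact: (@cvgD _ _ _ _ FF _ _ _ _ (@cvgN _ _ _ _ FF _ _ (gR x)) (fR x)).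
- move=> x; have -> : Im \o D = (fun x => - Im (g x) + Im (f x)).
    by apply/funext => y; rewrite /comp /D mulN1r cImD cImN.
  have FF := nbhs_filter x.
  exact: (@cvgD _ _ _ _ FF _ _ _ _ (@cvgN _ _ _ _ FF _ _ (gI x)) (fI x)).
Qed.

Lemma synth_cper a : rapid a -> continuous_periodic (synth a).
Proof.
move=> ra; have [c1 c2] := synth_continuous ra; split => //.
  exact: bdd_synth.
exact: synth_periodic.
Qed.

Lemma synth_inj a b : rapid a -> rapid b -> synth a = synth b -> a = b.
Proof.
by move=> ra rb h; apply/funext => xi; rewrite -(fhat_synth xi ra) -(fhat_synth xi rb) h.
Qed.

Lemma rapid_reflect a : rapid a -> rapid (fun xi => (a (- xi))^*%C).
Proof.
move=> ra p; have [C hC] := ra p; exists C => xi.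
by rewrite cmod_conj -bracketN.
Qed.

(** Conjugation reflects the frequencies, which the enumeration by [pickle] does not respect.
    Comparing Fourier coefficients replaces a reindexing of the series. *)
Lemma conj_synth a : rapid a ->
  (fun x => (synth a x)^*%C) = synth (fun xi => (a (- xi))^*%C).
Proof.
move=> ra; have rr := rapid_reflect ra.
have [ba pa aR aI] := synth_cper ra.
apply: fourier_inj; [|exact: synth_cper|].
  split; first exact: bdd_conj.
  - by move=> x k; rewrite pa.
  - by have -> : Re \o (fun x => (synth a x)^*%C) = Re \o synth a
      by apply/funext => x; rewrite /comp; case: (synth a x).
  - have -> : Im \o (fun x => (synth a x)^*%C) = (fun x => - Im (synth a x)).
      by apply/funext => x; rewrite /comp; case: (synth a x).
    by move=> x; exact: (@cvgN _ _ _ _ (nbhs_filter x) _ _ (aI x)).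
move=> xi; rewrite fhat_synth // -(fhat_synth (- xi) ra) /fhat opprK -mean_conj.
  congr mean; apply/funext => x.
  by rewrite rmorphM /= echarN.
by apply: bddM => //; exact: bdd_echar.
Qed.

End Inversion.

(** * Functions of class E_M *)

Section PureDerivatives.
Variables (R : realType) (n : nat).
Local Notation Z := 'rV[int]_n.
Local Notation Re := (@complex.Re R).
Local Notation Im := (@complex.Im R).
Implicit Types (f g : 'rV[R]_n -> R[i]) (x : 'rV[R]_n) (xi eta : Z) (a b : Z -> R[i]).

Lemma is_derive_line (phi : 'rV[R]_n -> R) x (v : 'rV[R]_n) (t : R) :
  derivable phi (x + t *: v) v ->
  is_derive t 1 (fun s => phi (x + s *: v)) (derive phi (x + t *: v) v).
Proof.
move=> hd.
have E : (fun h : R => h^-1 *: (((fun s => phi (x + s *: v)) \o shift t) (h *: (1 : R)) - phi (x + t *: v))) =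
  (fun h : R => h^-1 *: ((phi \o shift (x + t *: v)) (h *: v) - phi (x + t *: v))).
  apply/funext => h /=; congr (_ *: (phi _ - _)).
  by rewrite scalerDl addrCA /GRing.scale /= mulr1.
by apply: DeriveDef; rewrite /derivable /derive E.
Qed.

(** Taylor's estimate along lines, for real and imaginary parts; the bounded second derivative makes
    the remainder uniform. *)
Lemma uderiv_smooth j f : bdd f -> bdd (partial j f) -> bdd (partial j (partial j f)) ->
  (forall x, derivable (Re \o f) x (delta_mx 0 j) /\ derivable (Im \o f) x (delta_mx 0 j)) ->
  (forall x, derivable (Re \o partial j f) x (delta_mx 0 j) /\
             derivable (Im \o partial j f) x (delta_mx 0 j)) ->
  uderiv j f (partial j f).
Proof.
move=> bf bg [B hB] d1 d2; split => //; exists (2 * B) => x h _.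
rewrite (le_trans (cmod_le_ReIm _)) // -mulrA mulr_natl mulr2n lerD //.
- have h1 t := is_derive_line (proj1 (d1 (x + t *: edir R j))).
  have h2 t := is_derive_line (proj1 (d2 (x + t *: edir R j))).
  have hb t : `|derive (Re \o partial j f) (x + t *: edir R j) (delta_mx 0 j)| <= B.
    exact: le_trans (cmod_Re _) (hB (x + t *: edir R j)).
  have := taylor1 h h1 h2 hb.
  by rewrite !scale0r !addr0 !cReD !cReN cReM /= mul0r subr0 mulrC.
- have h1 t := is_derive_line (proj2 (d1 (x + t *: edir R j))).
  have h2 t := is_derive_line (proj2 (d2 (x + t *: edir R j))).
  have hb t : `|derive (Im \o partial j f) (x + t *: edir R j) (delta_mx 0 j)| <= B.
    exact: le_trans (cmod_Im _) (hB (x + t *: edir R j)).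
  have := taylor1 h h1 h2 hb.
  by rewrite !scale0r !addr0 !cImD !cImN cImM /= mul0r addr0 mulrC.
Qed.

Lemma periodic_partial j f : periodic2pi f -> periodic2pi (partial j f).
Proof.
move=> pf x k; set v := \row_j _.
have E (p : R[i] -> R) : (fun h : R => h^-1 *: (((p \o f) \o shift (x + v)) (h *: (delta_mx 0 j : 'rV[R]_n)) - p (f (x + v)))) =
    (fun h : R => h^-1 *: (((p \o f) \o shift x) (h *: (delta_mx 0 j : 'rV[R]_n)) - p (f x))).
  by apply/funext => h; rewrite /= addrA /v !pf.
by rewrite /partial /derive !E.
Qed.

Definition single (i : 'I_n) (k : nat) : 'I_n -> nat := fun j => if j == i then k else 0%N.

Lemma mdegree_single i k : mdegree (single i k) = k.
Proof.
rewrite /mdegree (bigD1 i) //= big1 ?addn0 /single ?eqxx // => j ne.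
by rewrite (negbTE ne).
Qed.

Lemma mpartial_single i k f : mpartial (single i k) f = iter k (partial i) f.
Proof.
rewrite /mpartial; have := enum_uniq 'I_n; have : i \in enum 'I_n by rewrite mem_enum.
elim: (enum 'I_n) => [//|j s ih]; rewrite inE /= => /orP[/eqP <-|is_] /andP[js us].
  rewrite /single eqxx; congr iter; elim: s js {ih us} => [//|l s ih].
  by rewrite inE negb_or eq_sym /= => /andP[/negbTE -> h] /=; exact: ih.
rewrite ih // {1}/single; case: eqP => [ji|//]; by rewrite ji is_ in js.
Qed.

Lemma mpartial0 f : mpartial (fun=> 0%N) f = f.
Proof. by rewrite /mpartial; elim: (enum _). Qed.

Lemma partials_nseq k i f : partials (nseq k i) f = iter k (partial i) f.
Proof. by elim: k => [//|k ih] /=; rewrite ih. Qed.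

Variable M : nat -> R.
Hypothesis hM : weight_sequence M.

Lemma E_M_continuous_periodic f : E_M M f -> continuous_periodic f.
Proof.
move=> [pf sf [C [h [C0 h0 hC]]]]; have [c1 c2 _ _] := sf [::]; split => //.
by eexists => x; have := hC (fun=> 0%N) x; rewrite mpartial0; exact.
Qed.

Lemma enorm0 : enorm R (0 : Z) = 0.
Proof. by rewrite /enorm big1 ?sqrtr0 // => j _; rewrite mxE expr0n. Qed.

(** Take the coordinate of largest modulus: as a nonzero integer it is at least 1, and the norm is
    at most [n] times it. Pure derivatives in one direction thus control every power of the
    bracket. *)
Lemma coord_dominates xi : xi != 0 ->
  exists i, bracket R xi <= n.+1%:R * `|(xi 0 i)%:~R|.
Proof.
move=> xi0; have [i0 hi0] : exists i0, xi 0 i0 != 0.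
  apply/existsP; apply: contraNT xi0; rewrite negb_exists => /forallP h.
  by apply/eqP/rowP => j; rewrite mxE; apply/eqP; have := h j; rewrite negbK.
case: (@arg_maxnP _ i0 xpredT (fun j => `|xi 0%R j|%N) isT) => i _ hi; exists i.
have le j : `|(xi 0 j)%:~R : R| <= `|(xi 0 i)%:~R : R|.
  by rewrite -!intr_norm ler_int -!abszE lez_nat; exact: hi.
have ge1 : 1 <= `|(xi 0 i)%:~R : R|.
  rewrite (le_trans _ (le i0)) // -intr_norm ler1z.
  by rewrite -gtz0_ge1 normr_gt0.
rewrite /bracket -natr1 mulrDl mul1r addrC lerD // (le_trans (enorm_le_sum _ _)) //.
rewrite (le_trans (ler_sum _ (fun j _ => le j))) //.
by rewrite sumr_const card_ord mulr_natl.
Qed.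

Lemma E_M_mdecay f : E_M M f -> mdecay M (fhat f).
Proof.
move=> [pf sf [C [h [C0 h0 hC]]]].
have hG i k x : cmod (iter k (partial i) f x) <= C * h ^+ k * wfact M k.
  by rewrite -mpartial_single /wfact mulrA -{2 3 4}(mdegree_single i k) hC.
have bG i k : bdd (iter k (partial i) f) by exists (C * h ^+ k * wfact M k).
have dG i k x : derivable (Re \o iter k (partial i) f) x (delta_mx 0 i) /\
    derivable (Im \o iter k (partial i) f) x (delta_mx 0 i).
  by rewrite -partials_nseq; have [_ _ h1 h2] := sf (nseq k i).
have pG i k : periodic2pi (iter k (partial i) f).
  by elim: k => [//|k ih] /=; exact: periodic_partial.
have uG i k : uderiv i (iter k (partial i) f) (iter k.+1 (partial i) f).
  exact: (uderiv_smooth (bG i k) (bG i k.+1) (bG i k.+2) (dG i k) (dG i k.+1)).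
have fG i k xi : fhat (iter k (partial i) f) xi = ('i%C * (xi 0 i)%:~R) ^+ k * fhat f xi.
  elim: k => [|k ih]; first by rewrite expr0 mul1r.
  by rewrite (fhat_uderiv xi (pG i k) (uG i k)) ih exprS mulrA.
have key i k xi : `|(xi 0 i)%:~R : R| ^+ k * cmod (fhat f xi) <= 2 * (C * h ^+ k * wfact M k).
  have -> : `|(xi 0 i)%:~R : R| ^+ k * cmod (fhat f xi) = cmod (fhat (iter k (partial i) f) xi).
    by rewrite fG cmodM cmodX cmodM cmod_i mul1r cmod_int.
  by apply: cmod_mean => x; rewrite cmodM cmod_echar mulr1.
have key0 : cmod (fhat f 0) <= 2 * C.
  apply: cmod_mean => x; rewrite cmodM cmod_echar mulr1.
  have := hC (fun=> 0%N) x; rewrite mpartial0 (_ : mdegree _ = 0%N); last by rewrite /mdegree big1.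
  by case: hM => _ [-> _] _ _; rewrite expr0 !mulr1.
(* [n.+1] comes from [coord_dominates]; the added 1 makes the base at least 1, as the frequency 0
   requires. *)
exists (2 * C), (1 + n.+1%:R * h); split.
- exact: mulr_gt0.
- by rewrite ltr_wpDr // mulr_ge0 // ltW.
move=> xi p; have w1 := wfact_ge1 hM p; have w0 := ltW (wfact_gt0 hM p).
have nh : 0 <= n.+1%:R * h by rewrite mulr_ge0 // ltW.
have [->|xi0] := eqVneq xi 0.
  rewrite /bracket enorm0 addr0 expr1n mulr1 (le_trans key0) // -mulrA.
  rewrite ler_peMr ?mulr_ge0 ?(ltW C0) //.
  by rewrite mulr_ege1 // exprn_ege1 // lerDl.
have [i hi] := coord_dominates xi0.
apply: (@le_trans _ _ (n.+1%:R ^+ p * (`|(xi 0 i)%:~R| ^+ p * cmod (fhat f xi)))).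
  rewrite mulrA -exprMn mulrC ler_wpM2r ?cmod_ge0 // lerXn2r ?nnegrE ?bracket_ge0 ?mulr_ge0 //.
rewrite (le_trans (ler_wpM2l _ (key i p xi))) ?exprn_ge0 //.
rewrite [leLHS](_ : _ = 2 * C * (n.+1%:R * h) ^+ p * wfact M p); last by rewrite exprMn; ring.
rewrite ler_wpM2r // ler_wpM2l ?mulr_ge0 ?(ltW C0) //.
by rewrite lerXn2r ?nnegrE ?addr_ge0 // lerDr.
Qed.

Lemma E_M_inversion f : E_M M f -> f = synth (fhat f).
Proof.
move=> hf; have hd := mdecay_rapid (E_M_mdecay hf).
apply: fourier_inj => [||xi]; [exact: E_M_continuous_periodic|exact: synth_cper|].
by rewrite fhat_synth.
Qed.

Lemma vekua_synth m (c : {ffun 'I_n -> 'I_m.+1} -> R[i]) (A B : R[i]) a : rapid a ->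
  let b xi := (symbol c xi - A) * a xi - B * (a (- xi))^*%C in
  rapid b /\ vekua_op c A B (synth a) = synth b.
Proof.
move=> ra b; have rr := rapid_reflect ra; have [rs es] := diffop_synth c ra.
have r1 : rapid (fun xi => - A * a xi + symbol c xi * a xi) by exact: rapid_lin.
have eb : b = (fun xi => - B * (a (- xi))^*%C + (- A * a xi + symbol c xi * a xi)).
  by apply/funext => xi; rewrite /b; ring.
rewrite eb; split; first exact: rapid_lin.
rewrite synth_lin // synth_lin // -conj_synth //; apply/funext => x.
by rewrite /vekua_op es; ring.
Qed.

Lemma symbol_poly m (c : {ffun 'I_n -> 'I_m.+1} -> R[i]) :
  exists K, forall xi, cmod (symbol c xi) <= K * bracket R xi ^+ m.
Proof.
exists (\sum_(alpha : {ffun 'I_n -> 'I_m.+1}) cmod (c alpha)) => xi.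
rewrite (le_trans (cmod_sum _ _ _)) // mulr_suml [leRHS](bigID (fun alpha => (0 < mdegree (bmi alpha) <= m)%N)) /=.
rewrite ler_wpDr ?sumr_ge0 // => [alpha _|]; first by rewrite mulr_ge0 ?cmod_ge0 ?bracketX_ge0.
apply: ler_sum => alpha /andP[_ hm].
have -> : 'i%C ^+ mdegree (bmi alpha) * c alpha * \prod_(j < n) (xi 0 j)%:~R ^+ bmi alpha j =
   c alpha * ximon R (bmi alpha) xi by rewrite /ximon; ring.
rewrite cmodM ler_wpM2l ?cmod_ge0 // (le_trans (cmod_ximon _ _ _)) //.
by rewrite ler_weXn2l // bracket_ge1.
Qed.

End PureDerivatives.

(** * Sufficiency *)

Section Gauge.
Variables (R : realType) (n : nat) (M : nat -> R).
Hypothesis hM : weight_sequence M.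
Local Notation Z := 'rV[int]_n.
Implicit Types (a b : Z -> R[i]) (xi eta : Z) (eps : R).

Definition gauge eps xi : R :=
  inf [set M j * j`!%:R / (eps ^+ j * (1 + enorm R xi) ^+ j) | j in [set: nat]].

Let term_ge0 eps xi j : 0 < eps -> 0 <= wfact M j / (eps ^+ j * bracket R xi ^+ j).
Proof.
move=> e0; rewrite divr_ge0 ?(ltW (wfact_gt0 hM _)) //.
by rewrite mulr_ge0 ?bracketX_ge0 // exprn_ge0 // ltW.
Qed.

Lemma gauge_le eps xi j : 0 < eps ->
  gauge eps xi <= wfact M j / (eps ^+ j * bracket R xi ^+ j).
Proof.
move=> e0; apply: ge_inf; last by exists j.
by exists 0 => _ [k _ <-]; exact: (@term_ge0 eps xi k e0).
Qed.

Lemma le_gauge eps xi (y : R) :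
  (forall j, y <= wfact M j / (eps ^+ j * bracket R xi ^+ j)) -> y <= gauge eps xi.
Proof.
move=> h; apply: lb_le_inf; last by move=> _ [k _ <-]; exact: (h k).
by exists (wfact M 0 / (eps ^+ 0 * bracket R xi ^+ 0)); exists 0%N.
Qed.

Lemma gaugeN eps xi : gauge eps (- xi) = gauge eps xi.
Proof. by rewrite /gauge enormN. Qed.

(** Up to index [N] the power is at most [N ^ N]; beyond it each further factor [N] is outweighed by
    the next factor of the factorial. *)
Lemma expn_le_fact N j : (N ^ j <= N ^ N * j`!)%N.
Proof.
have [->|N0] := posnP N; first by case: j => // j; rewrite exp0n.
elim: j => [|j ih]; first by rewrite muln1 expn_gt0 N0.
have [jN|Nj] := ltnP j N.
  by rewrite (leq_trans (leq_pexp2l N0 jN)) // leq_pmulr // fact_gt0.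
by rewrite expnS factS mulnCA leq_mul // (leq_trans Nj).
Qed.

(** An infimum of positive terms could vanish. With [N >= t], the chain t^j <= N^j <= N^N j! and
    [M j >= 1] keep all of them above N^-N. *)
Lemma gauge_gt0 eps xi : 0 < eps -> 0 < gauge eps xi.
Proof.
move=> e0; pose t := eps * bracket R xi.
have t0 : 0 < t by rewrite mulr_gt0 // bracket_gt0.
pose N := Num.Def.archi_bound t.
have tN : t <= N%:R := ltW (archi_boundP (ltW t0)).
have N0 : 0 < N%:R :> R := lt_le_trans t0 tN.
rewrite (lt_le_trans (y := (N%:R ^+ N)^-1)) ?invr_gt0 ?exprn_gt0 //.
apply: le_gauge => j; rewrite -exprMn -/t ler_pdivlMr ?exprn_gt0 //.
rewrite ler_pdivrMl ?exprn_gt0 // (le_trans (y := N%:R ^+ j)) //.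
  by rewrite lerXn2r ?nnegrE ?(ltW t0) ?(ltW N0).
rewrite (le_trans (y := N%:R ^+ N * j`!%:R)) //.
  by rewrite -!natrX -natrM ler_nat expn_le_fact.
rewrite ler_wpM2l ?exprn_ge0 ?(ltW N0) // /wfact ler_peMl //.
exact: weight_ge1.
Qed.

(* Splitting the index as [j + k] in both factors. *)
Lemma gauge_sqr eps : 0 < eps -> exists2 eps', 0 < eps' &
  forall xi, gauge eps xi <= gauge eps' xi ^+ 2.
Proof.
move=> e0; have [H H1 hH] := wfact_submul hM; have H0 := lt_le_trans ltr01 H1.
have d0 : 0 < eps / H by rewrite divr_gt0.
exists (eps / H) => // xi; set I' := gauge (eps / H) xi.
have I0 : 0 < I' by exact: gauge_gt0.
pose t j := wfact M j / ((eps / H) ^+ j * bracket R xi ^+ j).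
have b0 := bracket_gt0 R xi.
have tp j : 0 < t j.
  by rewrite /t; apply: divr_gt0; [exact: wfact_gt0|apply: mulr_gt0; exact: exprn_gt0].
have jk j k : gauge eps xi <= t j * t k.
  rewrite (le_trans (gauge_le xi (j + k) e0)) //.
  rewrite [leRHS](_ : _ = H ^+ (j + k) * wfact M j * wfact M k / (eps ^+ (j + k) * bracket R xi ^+ (j + k))).
    by rewrite ler_wpM2r ?hH // invr_ge0 mulr_ge0 ?exprn_ge0 ?(ltW e0) ?(ltW b0).
  rewrite /t !exprMn !exprD !exprVn; field.
  by rewrite !expf_eq0 !(gt_eqF e0) !(gt_eqF b0) !(gt_eqF H0) !andbF.
(* The infimum over [j] is taken with [k] fixed, then the infimum over [k]; positivity of [t k] and
   of [I'] permits both divisions. *)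
have k1 k : gauge eps xi / t k <= I'.
  by apply: le_gauge => j; rewrite ler_pdivrMr //; exact: jk.
rewrite expr2 -ler_pdivrMr //; apply: le_gauge => k.
by rewrite -/(t k) ler_pdivrMr // [leRHS]mulrC -ler_pdivrMr //; exact: k1.
Qed.

Lemma mdecay_gauge a K eps : 0 < K -> 0 < eps ->
  (forall xi, cmod (a xi) <= K * gauge eps xi) -> mdecay M a.
Proof.
move=> K0 e0 ha; exists K, eps^-1; split; rewrite ?invr_gt0 // => xi p.
have b0 := bracket_gt0 R xi.
rewrite (le_trans (ler_wpM2r (bracketX_ge0 _ _ _) (ha xi))) //.
rewrite -!mulrA ler_pM2l // -ler_pdivlMr ?exprn_gt0 //.
rewrite (le_trans (gauge_le xi p e0)) // le_eqVlt; apply/orP; left; apply/eqP.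
rewrite exprVn; field.
by rewrite !expf_eq0 (gt_eqF e0) (gt_eqF b0) !andbF.
Qed.

(* A rapidly decaying sequence divided by one not smaller than every gauge:
   half of the decay pays for the division. *)
Lemma mdecay_div a (d : Z -> R[i]) :
  mdecay M a ->
  (forall eps : R, 0 < eps -> exists C gamma : R, [/\ 0 < C, 0 < gamma &
     forall xi, gamma <= enorm R xi -> C * gauge eps xi <= cmod (d xi)]) ->
  mdecay M (fun xi => a xi / d xi).
Proof.
move=> [C [h [C0 h0 hC]]] hd; have [H H1 hH] := wfact_submul hM.
have H0 := lt_le_trans ltr01 H1; have hH0 : 0 < h * H by exact: mulr_gt0.
(* At this eps the gauge terms carry the powers of [h * H] that submultiplicativity produces. *)
have e0 : 0 < (h * H)^-1 by rewrite invr_gt0.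
have [D [gamma [D0 gamma0 hD]]] := hd _ e0.
apply: (@mdecay_far _ _ _ hM _ gamma (C / D) (h * H)) => //; first exact: divr_gt0.
move=> xi j hxi; have b0 := bracket_gt0 R xi; have wj := wfact_gt0 hM j.
have I0 := gauge_gt0 xi e0.
have d0 : 0 < cmod (d xi) by rewrite (lt_le_trans _ (hD xi hxi)) // mulr_gt0.
pose X := C * (h * H) ^+ j * wfact M j.
have X0 : 0 < X by rewrite (mulr_gt0 _ wj) // mulr_gt0 // exprn_gt0.
(* Decay of order [j + k] is used: [j] powers of the bracket stay with [a], the other [k] give the
   gauge term of index [k], and the infimum is over [k] with [j] fixed. *)
have key : cmod (a xi) * bracket R xi ^+ j / X <= gauge (h * H)^-1 xi.
  apply: le_gauge => k; rewrite ler_pdivrMr // exprVn.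
  have E : wfact M k / (((h * H) ^+ k)^-1 * bracket R xi ^+ k) * X =
     C * h ^+ (j + k) * (H ^+ (j + k) * wfact M j * wfact M k) / bracket R xi ^+ k.
    rewrite /X !exprMn !exprD; field.
    by rewrite !expf_eq0 (gt_eqF h0) (gt_eqF H0) (gt_eqF b0) !andbF.
  rewrite E ler_pdivlMr ?exprn_gt0 // -[leLHS]mulrA -exprD (le_trans (hC xi _)) //.
  by rewrite ler_wpM2l ?hH // mulr_ge0 ?exprn_ge0 ?(ltW C0) ?(ltW h0).
rewrite cmodM cmodV mulrAC ler_pdivrMr //.
rewrite ler_pdivrMr // in key; rewrite (le_trans key) //.
have -> : C / D * (h * H) ^+ j * wfact M j * cmod (d xi) = cmod (d xi) / D * X.
  by rewrite /X; ring.
by rewrite ler_wpM2r ?(ltW X0) // ler_pdivlMr // mulrC hD.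
Qed.

End Gauge.

(** * Cramer's rule and solutions in the class *)

Section Solvability.
Variables (R : realType) (n m : nat) (M : nat -> R) (A B : R[i]).
Variable c : {ffun 'I_n -> 'I_m.+1} -> R[i].
Hypothesis hM : weight_sequence M.
Local Notation Z := 'rV[int]_n.
Local Notation sigma := (symbol c).
Local Notation D := (Delta c A B).

Implicit Types (a b v g : Z -> R[i]) (xi eta : Z).

Definition cofactor_term g xi : R[i] := ((sigma (- xi))^*%C - A^*%C) * g xi + B * (g (- xi))^*%C.

Lemma mul_conj_cmod (z : R[i]) : z * z^*%C = ((cmod z) ^+ 2)%:C%C.
Proof.
case: z => x y; rewrite /cmod /= sqr_sqrtr ?addr_ge0 ?sqr_ge0 //.
by apply: complex_ext => /=; ring.
Qed.

(** The equation at [- xi], conjugated, belongs to the same linear system. Hence the quotients for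
    [v xi] and for the conjugate of [v (- xi)] share a denominator. *)
Lemma Delta_conj xi : D (- xi) = (D xi)^*%C.
Proof.
rewrite /Delta opprK cconjB cconjM !cconjB !cconjK; congr (_ - _); first by rewrite mulrC.
by apply: complex_ext; rewrite /= ?oppr0.
Qed.

(* Cramer's rule for the linear system in [v xi] and [conj (v (- xi))]. *)
Lemma Delta_mul v g :
  (forall xi, (sigma xi - A) * v xi - B * (v (- xi))^*%C = g xi) ->
  forall xi, D xi * v xi = cofactor_term g xi.
Proof.
move=> h xi; rewrite /cofactor_term -!h opprK cconjB !cconjM cconjB !cconjK.
rewrite /Delta -mul_conj_cmod; ring.
Qed.

Lemma cofactor_solves g v xi : D xi != 0 -> v xi = cofactor_term g xi / D xi ->
  v (- xi) = cofactor_term g (- xi) / D (- xi) ->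
  (sigma xi - A) * v xi - B * (v (- xi))^*%C = g xi.
Proof.
move=> d0 -> ->; rewrite Delta_conj /cofactor_term opprK.
rewrite cconjM cconjV !cconjK cconjD !cconjM cconjB !cconjK.
apply: (mulIf d0); rewrite mulrBl ![_ * (_ / _)]mulrA !divfK //.
rewrite [X in _ = _ * X]/Delta -mul_conj_cmod; ring.
Qed.

Lemma mdecay_cofactor g : mdecay M g -> mdecay M (cofactor_term g).
Proof.
move=> mg; have [K hK] := symbol_poly c.
have m1 : mdecay M (fun xi => ((sigma (- xi))^*%C - A^*%C) * g xi).
  apply: (mdecay_poly hM (K := K + cmod A) (q := m) mg) => xi.
  rewrite cmodM ler_wpM2r ?cmod_ge0 // (le_trans (cmodB _ _)) // !cmod_conj mulrDl.
  rewrite lerD //; first by rewrite -bracketN.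
  by rewrite ler_peMr ?cmod_ge0 // exprn_ege1 // bracket_ge1.
have := mdecay_lin hM B (mdecay_reflect mg) m1.
by congr mdecay; apply/funext => xi; rewrite addrC.
Qed.

Lemma solvable_of_lower_bound :
  (forall eps : R, 0 < eps -> exists C gamma : R, [/\ 0 < C, 0 < gamma &
     forall xi, gamma <= enorm R xi -> C * gauge M eps xi <= cmod (D xi)]) ->
  M_solvable M (vekua_op c A B).
Proof.
(* One value of eps suffices to find a ball outside which [D] has no zero. *)
move=> hD; have [C1 [r [C10 r0 h1]]] := hD 1 ltr01.
have Dn0 xi : r <= enorm R xi -> D xi != 0.
  move=> hx; rewrite -cmod_gt0 (lt_le_trans _ (h1 xi hx)) // mulr_gt0 //.
  exact: gauge_gt0.
have [N0 hN0] := pickle_bounded n r.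
pose S a := mdecay M a /\ forall xi, (pickle xi < N0)%N -> a xi = 0.
exists [set synth a | a in S].
  have fin0 a N : (forall xi, (N <= pickle xi)%N -> a xi = 0) -> mdecay M a by exact: mdecay_finite.
  split.
  - by move=> _ [a [ma _] <-]; exact: E_M_synth.
  - exists (fun=> 0); last exact: synth0.
    by split => //; exact: (fin0 _ 0%N).
  - move=> z _ _ [a [ma a0] <-] [b [mb b0] <-].
    exists (fun xi => z * a xi + b xi); last exact: synth_lin (mdecay_rapid ma) (mdecay_rapid mb).
    split; first exact: mdecay_lin.
    by move=> xi hx; rewrite a0 // b0 // mulr0 addr0.
  - pose d (i : 'I_N0) (xi : Z) : R[i] := if pickle xi == i then 1 else 0.
    have md i : mdecay M (d i).
      apply: (fin0 _ i.+1) => xi hx; rewrite /d; case: eqP => // e.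
      by move: hx; rewrite e ltnn.
    exists N0, (fun i => synth (d i)); split; first by move=> i; exact: E_M_synth.
    move=> f hf; pose a := fhat f.
    have ma : mdecay M a by exact: E_M_mdecay.
    exists (fun i => enum_term a i).
    pose a' xi : R[i] := if (pickle xi < N0)%N then 0 else a xi.
    have ma' : mdecay M a'.
      apply: (mdecay_poly hM (K := 1) (q := 0) ma) => xi; rewrite !mul1r /a'.
      by case: ifP => // _; rewrite cmod0 cmod_ge0.
    have rd i : rapid (d i) by exact: mdecay_rapid (md i).
    have [rs es] := synth_sum (index_enum 'I_N0) xpredT (fun i : 'I_N0 => enum_term a i) rd.
    exists a'; first by split => // xi hx; rewrite /a' hx.
    rewrite (E_M_inversion hM hf) -/a.
    have ea : a = (fun xi => 1 * (\sum_(i < N0) enum_term a i * d i xi) + a' xi).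
      apply/funext => xi; rewrite mul1r /a'; case: ifPn => hx.
        rewrite addr0 (bigD1 (Ordinal hx)) //= /d eqxx mulr1 /enum_term pickleK_inv /=.
        rewrite big1 ?addr0 // => i ne; case: eqP => [e|_]; last by rewrite mulr0.
        by case/eqP: ne; apply/val_inj.
      rewrite big1 ?add0r // => i _; rewrite /d; case: eqP => [e|_]; last by rewrite mulr0.
      by move: hx; rewrite e ltn_ord.
    have -> : synth a = (fun x => 1 * (\sum_(i < N0) enum_term a i * synth (d i) x) + synth a' x).
      by rewrite {1}ea (synth_lin 1 rs (mdecay_rapid ma')) es.
    by apply/funext => x; rewrite mul1r addrAC subrr add0r.
move=> _ [a [ma a0] <-].
pose G := cofactor_term a.
have mq : mdecay M (fun xi => G xi / D xi).
  exact: (mdecay_div hM (mdecay_cofactor ma) hD).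
(* The cut is by norm and not by code, since the ball is symmetric under [xi] to [- xi] and the set
   of small codes need not be. Inside the ball both unknowns vanish and so does the datum. *)
pose v xi : R[i] := if enorm R xi < r then 0 else G xi / D xi.
have mv : mdecay M v.
  apply: (mdecay_poly hM (K := 1) (q := 0) mq) => xi; rewrite !mul1r /v.
  by case: ifP => // _; rewrite cmod0 cmod_ge0.
exists (synth v); first exact: E_M_synth.
have [_ ->] := vekua_synth c A B (mdecay_rapid mv).
congr synth; apply/funext => xi.
have [hx|hx] := ltP (enorm R xi) r.
  by rewrite /v enormN hx conjc0 !mulr0 subrr a0 // hN0.
apply: cofactor_solves; first exact: Dn0.
  by rewrite /v ltNge hx.
by rewrite /v enormN ltNge hx.
Qed.

End Solvability.

(** * Necessity *)

Section Necessity.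
Variables (R : realType) (n m : nat) (M : nat -> R) (A B : R[i]).
Variable c : {ffun 'I_n -> 'I_m.+1} -> R[i].
Hypothesis hM : weight_sequence M.
Local Notation Z := 'rV[int]_n.
Local Notation sigma := (symbol c).
Local Notation D := (Delta c A B).
Implicit Types (a b v g : Z -> R[i]) (xi eta zeta : Z).

(* At [zeta] a bounded solution [v] forces [g zeta] to be smaller than the gauge
   by a factor that improves with [l]. *)
Lemma bad_frequencies eps : 0 < eps ->
  (forall C gamma : R, 0 < C -> 0 < gamma ->
     exists2 xi, gamma <= enorm R xi & cmod (D xi) < C * gauge M eps xi) ->
  exists eps' kappa : R, [/\ 0 < eps', 0 < kappa &
    forall (l : nat) (gamma : R), 0 < gamma -> exists2 zeta, gamma <= enorm R zeta &
      forall v g (V : R),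
        (forall xi, (sigma xi - A) * v xi - B * (v (- xi))^*%C = g xi) ->
        g (- zeta) = 0 -> (forall xi, cmod (v xi) <= V) ->
        kappa * l.+1%:R * cmod (g zeta) ^+ 2 <= (V * gauge M eps' zeta) ^+ 2].
Proof.
move=> e0 hbad.
have l0 (l : nat) : 0 < (l.+1%:R)^-1 :> R by rewrite invr_gt0 ltr0n.
(* For nonzero [B] take [zeta = - xi]: the cofactor at [xi] reduces to [B] times the conjugate of
   [g zeta]. *)
have [B0|B0] := eqVneq B 0; last first.
  have b0 : 0 < cmod B by rewrite cmod_gt0.
  exists eps, (cmod B ^+ 2); split => //; first by rewrite exprn_gt0.
  move=> l gamma g0; have [xi hx hD] := hbad _ gamma (l0 l) g0.
  exists (- xi); first by rewrite enormN.
  move=> v g V hv; rewrite opprK gaugeN => gx hV.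
  have := congr1 (@cmod R) (Delta_mul hv xi).
  rewrite /cofactor_term gx mulr0 add0r !cmodM cmod_conj => E.
  have V0 : 0 <= V := le_trans (cmod_ge0 _) (hV 0).
  have I0 := gauge_gt0 hM xi e0.
  have h : cmod B * cmod (g (- xi)) <= l.+1%:R^-1 * (V * gauge M eps xi).
    rewrite -E [leRHS](_ : _ = l.+1%:R^-1 * gauge M eps xi * V); last by ring.
    by rewrite ler_pM ?cmod_ge0 ?(ltW hD).
  rewrite ler_pdivlMl ?ltr0n // in h.
  (* The estimate here is linear in the datum; it is squared, and [l.+1 ^+ 2] weakened to [l.+1], to
     match the case [B = 0], where only a square is controlled. *)
  apply: (@le_trans _ _ ((l.+1%:R * (cmod B * cmod (g (- xi)))) ^+ 2)).
    rewrite [leRHS](_ : _ = l.+1%:R ^+ 2 * (cmod B ^+ 2 * cmod (g (- xi)) ^+ 2)); last by ring.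
    rewrite mulrAC [leLHS]mulrC; apply: ler_wpM2r; first by rewrite mulr_ge0 ?sqr_ge0.
    by rewrite expr2 ler_peMr // ler1n.
  by rewrite lerXn2r ?nnegrE ?mulr_ge0 ?cmod_ge0 ?(ltW I0).
(* For [B = 0] the determinant has modulus [s xi * s (- xi)]. The frequency with the smaller factor
   satisfies [s zeta ^+ 2 <= cmod (D xi)], and [gauge_sqr] turns this into a bound by the square of
   a gauge. *)
have [eps' e'0 hsq] := gauge_sqr n hM e0.
exists eps', 1; split => // l gamma g0; have [xi hx hD] := hbad _ gamma (l0 l) g0.
pose s eta := cmod (sigma eta - A).
have ED : cmod (D xi) = s xi * s (- xi).
  rewrite /Delta B0 cmod0 expr0n subr0 cmodM; congr (_ * _).
  by rewrite -cconjB cmod_conj.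
have [zeta [hz Iz sz]] : exists zeta, [/\ gamma <= enorm R zeta,
    gauge M eps' zeta = gauge M eps' xi & s zeta ^+ 2 <= cmod (D xi)].
  have [h|h] := leP (s xi) (s (- xi)).
    by exists xi; split => //; rewrite ED expr2 ler_wpM2l ?cmod_ge0.
  exists (- xi); split; rewrite ?enormN ?gaugeN //.
  by rewrite ED expr2 ler_wpM2r ?cmod_ge0 ?ltW.
exists zeta => // v g V hv _ hV.
have V0 : 0 <= V := le_trans (cmod_ge0 _) (hV 0).
rewrite -hv B0 mul0r subr0 cmodM -/(s zeta) mul1r !exprMn Iz.
have -> : l.+1%:R * (s zeta ^+ 2 * cmod (v zeta) ^+ 2) =
    cmod (v zeta) ^+ 2 * (l.+1%:R * s zeta ^+ 2) by ring.
apply: ler_pM; first exact: sqr_ge0.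
- by rewrite mulr_ge0 ?sqr_ge0.
- by rewrite lerXn2r ?nnegrE ?cmod_ge0.
rewrite -ler_pdivlMl ?ltr0n // (le_trans sz) // (le_trans (ltW hD)) //.
by rewrite ler_wpM2l ?hsq // ltW.
Qed.

Lemma left_kernel_exists (F : fieldType) k (Q : 'M[F]_(k.+1, k)) :
  exists2 b : 'I_k.+1 -> F, (exists i, b i != 0) & forall r, \sum_i b i * Q i r = 0.
Proof.
have K0 : kermx Q != 0.
  rewrite kermx_eq0 /row_free neq_ltn; apply/orP; left.
  by rewrite ltnS rank_leq_col.
pose w := nz_row (kermx Q).
have w0 : w != 0 by rewrite nz_row_eq0.
have wQ : w *m Q = 0 by apply/sub_kermxP; exact: nz_row_sub.
exists (fun i => w 0 i).
  apply/existsP; apply: contraNT w0; rewrite negb_exists => /forallP h.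
  by apply/eqP/rowP => j; rewrite mxE; apply/eqP; have := h j; rewrite negbK.
by move=> r; have /rowP /(_ r) := wQ; rewrite !mxE.
Qed.

(** Modulo [F] the [k.+1] functions are combinations of [k] fixed ones; a left kernel vector of the
    coefficient matrix cancels these. *)
Lemma finite_codim_combination (T : Type) (F E : set (T -> R[i])) :
  finite_codim_subspace F E ->
  exists k, forall f : 'I_k.+1 -> T -> R[i], (forall i, E (f i)) ->
    exists2 b : 'I_k.+1 -> R[i], (exists i, b i != 0) & F (fun x => \sum_i b i * f i x).
Proof.
move=> [FE F0 Flin [k [e [he hspan]]]]; exists k => f hf.
have [Q hQ] := choice (fun i => hspan _ (hf i)).
have [b b0 hb] := left_kernel_exists (\matrix_(i, r) Q i r).
exists b => //.
have Fsum (s : seq 'I_k.+1) : F (fun x => \sum_(i <- s) b i * (f i x - \sum_(r < k) Q i r * e r x)).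
  elim: s => [|i s ih]; first by under eq_fun do rewrite big_nil.
  under eq_fun do rewrite big_cons.
  exact: Flin.
have := Fsum (index_enum _); congr F; apply/funext => x.
under eq_bigr do rewrite mulrBr; rewrite sumrB [X in _ - X](_ : _ = 0) ?subr0 //.
under eq_bigr do rewrite mulr_sumr; rewrite exchange_big big1 //= => r _.
under eq_bigr do rewrite mulrA; rewrite -mulr_suml.
have := hb r; under eq_bigr do rewrite mxE.
by move=> ->; rewrite mul0r.
Qed.

Lemma lower_bound_of_solvable : M_solvable M (vekua_op c A B) ->
  forall eps : R, 0 < eps -> exists C gamma : R, [/\ 0 < C, 0 < gamma &
     forall xi, gamma <= enorm R xi -> C * gauge M eps xi <= cmod (D xi)].
Proof.
move=> [F hF hsol] eps e0; apply: contrapT => hneg.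
have hbad (C gamma : R) : 0 < C -> 0 < gamma ->
     exists2 xi, gamma <= enorm R xi & cmod (D xi) < C * gauge M eps xi.
  move=> C0 g0; apply: contrapT => h; apply: hneg; exists C, gamma; split => // xi hx.
  by rewrite leNgt; apply/negP => lt; apply: h; exists xi.
have [eps' [kappa [e'0 kappa0 hz]]] := bad_frequencies e0 hbad.
pose bad (l : nat) zeta := forall v g (V : R),
        (forall xi, (sigma xi - A) * v xi - B * (v (- xi))^*%C = g xi) ->
        g (- zeta) = 0 -> (forall xi, cmod (v xi) <= V) ->
        kappa * l.+1%:R * cmod (g zeta) ^+ 2 <= (V * gauge M eps' zeta) ^+ 2.
have next (lz : nat * Z) : exists z, enorm R lz.2 + 1 <= enorm R z /\ bad lz.1 z.
  have [zeta h1 h2] := hz lz.1 (enorm R lz.2 + 1) (ltr_wpDl (enorm_ge0 R lz.2) ltr01).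
  by exists zeta; split.
have [pk hpk] := choice next.
(* Norms start at 1 or more and increase by at least 1. A point thus determines its index, and
   [- zs l] is never one of the points: equal norms would force [zs l = - zs l]. *)
pose zs := fix zs l := if l is l'.+1 then pk (l, zs l') else pk (0%N, 0).
have zs_bad l : bad l (zs l).
  by case: l => [|l]; [have [] := hpk (0%N, 0)|have [] := hpk (l.+1, zs l)].
have zs_step l : enorm R (zs l) < enorm R (zs l.+1).
  have [h _] := hpk (l.+1, zs l); rewrite (lt_le_trans _ h) //= ltrDl ltr01 //.
have zs_ge1 l : 1 <= enorm R (zs l).
  elim: l => [|l ih]; last exact: le_trans ih (ltW (zs_step l)).
  by have [h _] := hpk (0%N, 0); rewrite (le_trans _ h) // lerDr enorm_ge0.
have zs_inj l l' : enorm R (zs l) = enorm R (zs l') -> l = l'.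
  have mono i j : (i < j)%N -> enorm R (zs i) < enorm R (zs j).
    elim: j => [//|j ih]; rewrite ltnS leq_eqVlt => /orP[/eqP -> //|/ih h].
    exact: lt_trans h (zs_step j).
  by case: (ltngtP l l') => // /mono; [move=> + e|move=> + e]; rewrite e ltxx.
have [k hk] := finite_codim_combination hF.
(* Splitting the indices by residue modulo [k.+1] gives disjoint infinite supports, so a single
   nonzero coefficient of the combination is seen at infinitely many frequencies. *)
pose a (i : 'I_k.+1) xi : R[i] :=
  if `[< exists2 l, (l %% k.+1)%N = i & xi = zs l >] then (gauge M eps' xi)%:C%C else 0.
have ma i : mdecay M (a i).
  apply: (@mdecay_gauge _ _ _ hM _ 1 eps') => // xi; rewrite mul1r /a.
  have I0 := ltW (gauge_gt0 hM xi e'0).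
  by case: ifP => _; rewrite ?cmod0 // cmod_real ger0_norm.
have [b [i0 bi0] hb] := hk _ (fun i => E_M_synth hM (ma i)).
have ra i : rapid (a i) := mdecay_rapid (ma i).
have [rg eg] := synth_sum (index_enum 'I_k.+1) xpredT b ra.
have [u hu] := hsol _ hb; rewrite (E_M_inversion hM hu) -eg.
set v := fhat u; have mv : mdecay M v := E_M_mdecay hM hu.
set g := (fun xi => \sum_i b i * a i xi) in rg *.
have [rv ->] := vekua_synth c A B (mdecay_rapid mv).
move=> /(synth_inj rv rg) hv.
have hvg xi : (sigma xi - A) * v xi - B * (v (- xi))^*%C = g xi by rewrite -hv.
have [V hV] := mdecay_bdd mv.
have g_neg l : g (- zs l) = 0.
  rewrite /g big1 // => i _; rewrite /a; case: asboolP; last by rewrite mulr0.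
  move=> [l' _ e]; have el : l = l' by apply: zs_inj; rewrite -e enormN.
  rewrite -{l'}el in e; exfalso.
  have z0 : zs l = 0.
    by apply/rowP => j; have /rowP /(_ j) := e; rewrite !mxE; move: (zs l _ _) => y; lia.
  by have := zs_ge1 l; rewrite z0 enorm0 ler10.
have g_at q : let l := (q * k.+1 + i0)%N in g (zs l) = b i0 * (gauge M eps' (zs l))%:C%C.
  move=> l; have il : (l %% k.+1)%N = i0 by rewrite /l modnMDl modn_small.
  rewrite /g (bigD1 i0) //= big1 ?addr0.
    by rewrite /a; case: asboolP => // h; case: h; exists l.
  move=> i ne; rewrite /a; case: asboolP; last by rewrite mulr0.
  move=> [l' il' e]; have el : l = l' by apply: zs_inj; rewrite -e.
  by case/eqP: ne; apply/val_inj; rewrite /= -il' -el il.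
have b2 : 0 < kappa * cmod (b i0) ^+ 2 by rewrite mulr_gt0 // exprn_gt0 // cmod_gt0.
(* The index [q * k.+1 + i0] is at least [q], so its successor exceeds this quotient; the
   bad-frequency estimate fails there once the squared gauge is cancelled. *)
pose q := Num.Def.archi_bound (V ^+ 2 / (kappa * cmod (b i0) ^+ 2)).
have hq : V ^+ 2 / (kappa * cmod (b i0) ^+ 2) < q%:R.
  by apply: archi_boundP; rewrite divr_ge0 ?sqr_ge0 ?(ltW b2).
pose l := (q * k.+1 + i0)%N.
have := zs_bad l v g V hvg (g_neg l) hV.
have I0 := gauge_gt0 hM (zs l) e'0.
rewrite g_at -/l cmodM cmod_real (gtr0_norm I0) !exprMn mulrA ler_pM2r ?exprn_gt0 //.
rewrite leNgt => /negP; apply.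
rewrite ltr_pdivrMr // in hq; rewrite (lt_le_trans hq) //.
rewrite mulrAC [leRHS]mulrC ler_wpM2r ?(ltW b2) // ler_nat.
by rewrite /l -addn1 (leq_trans (leq_pmulr q (ltn0Sn k))) // -addnA leq_addr.
Qed.

End Necessity.

Theorem theorem3p2 (R : realType) (M : nat -> R) (hM : weight_sequence M)
    (n m : nat) (A B : R[i]) (c : {ffun 'I_n -> 'I_m.+1} -> R[i]) :
  M_solvable M (vekua_op c A B) <->
  (forall eps : R, 0 < eps ->
    exists C gamma : R, [/\ 0 < C, 0 < gamma &
      forall xi : 'rV[int]_n, gamma <= enorm R xi ->
        C * inf [set M j * j`!%:R / (eps ^+ j * (1 + enorm R xi) ^+ j)
                | j in [set: nat]]
          <= cmod (Delta c A B xi)]).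
Proof.
split; first exact: lower_bound_of_solvable.
exact: solvable_of_lower_bound.
Qed.
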